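(* Let $\{X_t^N\}_{t\ge 0}$ be the $N$-urn branching process with rate functions $\{\lambda_k\}_{k\ge 0}$, $\{\psi_k\}_{k\ge 0}$ described in the context, and suppose that $\{X_0^N(i)\}_{1\le i\le N}$ are independent with $X_0^N(i)$ Poisson distributed with mean $\phi(i/N)$ for all $1\le i\le N$, where $\phi\in C^\infty(\mathbb{T})$. For any $t\ge 0$, there exists $C_1=C_1(t)<+\infty$ independent of $N$ such that $$\left|\mathrm{Cov}\left(X_s^N(i),X_s^N(j)\right)\right|\le\frac{C_1}{N}$$ for all $N\ge 1$, $1\le i\ne j\le N$ and $0\le s\le t$.
   Context: $\mathbb{T}=(0,1]$ is the one-dimensional torus. For $k\ge 0$, $\lambda_k\in C^\infty(\mathbb{T}^2)$ and $\psi_k\in C^\infty(\mathbb{T})$ are nonnegative functions such that, for some $\varepsilon_0>0$, $\sup_{u,v\in\mathbb{T}}\sum_{k\ge 0}k^{2+\varepsilon_0}\lambda_k(u,v)<+\infty$, $\sup_{u\in\mathbb{T}}\sum_{k\ge 0}k^{2+\varepsilon_0}\psi_k(u)<+\infty$, and $\sum_{k\ge 0}k^{2+\varepsilon_0}\lambda_k\in C^\infty(\mathbb{T}^2)$, $\sum_{k\ge 0}k^{2+\varepsilon_0}\psi_k\in C^\infty(\mathbb{T})$. The function $\phi$ is nonnegative. The $N$-urn branching process ($N\ge 1$): $X_t^N=(X_t^N(1),\dots,X_t^N(N))$ is a continuous-time Markov process on $\{0,1,2,\dots\}^N$, where $X_t^N(i)$ is the number of particles in urn $i$ at time $t$. For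 $1\le i\ne j\le N$ and $k\ge 0$, each particle in urn $i$ dies and simultaneously gives birth to $k$ new particles in urn $j$ at rate $\frac1N\lambda_k(\frac iN,\frac jN)$. For $1\le i\le N$ and $k\ge 0$, each particle in urn $i$ dies and simultaneously gives birth to $k$ new particles in urn $i$ at rate $\psi_k(\frac iN)$. Equivalently, the generator is $$\mathcal{L}_Nf(x)=\frac1N\sum_{k=0}^{+\infty}\sum_{i=1}^N\sum_{j\ne i}x(i)\lambda_k\left(\tfrac iN,\tfrac jN\right)\left(f(x_k^{(i,j)})-f(x)\right)+\sum_{k=0}^{+\infty}\sum_{i=1}^N x(i)\psi_k\left(\tfrac iN\right)\left(f(x^i_{k-1})-f(x)\right),$$ where $x_k^{(i,j)}$ is obtained from $x$ by replacing $x(i)$ by $x(i)-1$ and $x(j)$ by $x(j)+k$, and $x^i_{k}$ is obtained from $x$ by replacing $x(i)$ by $x(i)+k$. *)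

(* Defs.v *)
From HB Require Import structures.
From mathcomp Require Import all_boot all_order all_algebra.
From mathcomp Require Import all_classical all_reals all_analysis.

Set Implicit Arguments.
Unset Strict Implicit.
Unset Printing Implicit Defensive.

Import Order.TTheory GRing.Theory Num.Theory.
Import numFieldNormedType.Exports.

Local Open Scope classical_set_scope.
Local Open Scope ring_scope.

Section smoothness.
Context {R : realType}.

(* All directional derivatives up to order n exist and are continuous; on a
   finite-dimensional V this is the usual class C^n. *)
Fixpoint class_C (V : normedModType R) (n : nat) (f : V -> R) : Prop :=
  match n with
  | 0 => continuous f
  | m.+1 => continuous f /\
      forall v : V, (forall x, derivable f x v) /\
                    class_C m (fun x => 'D_v f x)
  end.

Definition smooth (V : normedModType R) (f : V -> R) : Prop :=
  forall n, class_C n f.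

(* The torus (0, 1] is R / Z, so a function on it is a 1-periodic function on
   R, and it is smooth on the torus when this periodic function is smooth. *)
Definition torus : set R := `]0, 1]%classic.

Definition torus_smooth (f : R -> R) : Prop := periodic f 1 /\ smooth f.

Definition torus2_smooth (f : R -> R -> R) : Prop :=
  [/\ forall v, periodic (f^~ v) 1,
      forall u, periodic (f u) 1 &
      smooth (fun z : R * R => f z.1 z.2)].

Definition weighted_sum (e : R) (a : nat -> R) : \bar R :=
  (\sum_(0 <= k <oo) (k%:R `^ (2 + e) * a k)%:E)%E.

End smoothness.

Definition urn_state (N : nat) : Type := {ffun 'I_N -> nat}.

HB.instance Definition _ N := Choice.on (urn_state N).
HB.instance Definition _ N := isPointed.Build (urn_state N) [ffun=> 0%N].
HB.instance Definition _ N := @isMeasurable.Build default_measure_display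
  (urn_state N) discrete_measurable discrete_measurable0
  discrete_measurableC discrete_measurableU.

Section urn_generator.
Context {R : realType} {N : nat}.

(* Urns are numbered from 0 here, so that i : 'I_N is the urn i + 1, which
   sits at the point (i + 1) / N of the torus. *)
Definition site (i : 'I_N) : R := i.+1%:R / N%:R.

(* Truncated predecessors are harmless in the next two definitions: an empty
   urn i has rate x i = 0 in the generator. *)
Definition move (k : nat) (i j : 'I_N) (x : urn_state N) : urn_state N :=
  [ffun l => if l == i then (x i).-1
             else if l == j then (x j + k)%N else x l].

Definition stay (k : nat) (i : 'I_N) (x : urn_state N) : urn_state N :=
  [ffun l => if l == i then (x i + k).-1 else x l].

Definition urn_generator (lam : nat -> R -> R -> R) (psi : nat -> R -> R)
    (f : urn_state N -> R) (x : urn_state N) : R :=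
  N%:R^-1 * limn (series (fun k =>
      \sum_(i < N) \sum_(j < N | j != i)
        (x i)%:R * lam k (site i) (site j) * (f (move k i j x) - f x)))
  + limn (series (fun k =>
      \sum_(i < N) (x i)%:R * psi k (site i) * (f (stay k i x) - f x))).

End urn_generator.

Section markov_process.
Context {R : realType} {d : measure_display} {S : measurableType d}.

Record transition_semigroup (p : R -> R.-pker S ~> S) : Prop := {
  semigroup0 : forall x A, measurable A -> p 0 x A = \d_x A;
  semigroupD : forall s t x A, 0 <= s -> 0 <= t -> measurable A ->
    p (s + t) x A = (\int[p s x]_y p t y A)%E }.

(* The limit is pointwise in x: for a process with unbounded total jump rates
   the uniform limit need not exist, even for bounded f. *)
Definition has_generator (p : R -> R.-pker S ~> S)
    (L : (S -> R) -> S -> R) : Prop :=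
  forall f : S -> R, measurable_fun setT f -> bounded_fun f -> forall x,
    h^-1 * (\int[p h x]_y f y - f x) @[h --> 0^'+] --> L f x.

Context {d' : measure_display} {T : measurableType d'} {P : probability T R}.

Definition history (X : R -> {RV P >-> S}) (s : R) : set (set T) :=
  <<s \bigcup_(r in `[0, s]) preimage_set_system setT (X r) measurable >>.

(* Markov property on a countable state space; only times t >= 0 matter. *)
Definition markov_process (p : R -> R.-pker S ~> S)
    (X : R -> {RV P >-> S}) : Prop :=
  forall s t, 0 <= s -> 0 <= t -> forall A, history X s A ->
  forall x B, measurable B ->
    P (A `&` X s @^-1` [set x] `&` X (s + t) @^-1` B) =
    (P (A `&` X s @^-1` [set x]) * p t x B)%E.

End markov_process.

Section urn_process.
Context {R : realType} {N : nat} {d : measure_display} {T : measurableType d}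
  {P : probability T R}.

Definition urn_branching_process (lam : nat -> R -> R -> R)
    (psi : nat -> R -> R) (X : R -> {RV P >-> urn_state N}) : Prop :=
  exists p : R -> R.-pker (urn_state N) ~> (urn_state N),
    [/\ transition_semigroup p,
        has_generator p (urn_generator lam psi) &
        markov_process p X].

Definition independent_coords (Y : T -> urn_state N) : Prop :=
  forall (J : {set 'I_N}) (B : 'I_N -> set nat),
    P (\bigcap_(i in [set` J]) [set w | B i (Y w i)]) =
    (\prod_(i in J) P [set w | B i (Y w i)])%E.

(* The second argument of poisson_prob is ignored by the library; for mean 0
   poisson_prob is the Dirac mass at 0. *)
Definition poisson_coords (phi : R -> R) (Y : T -> urn_state N) : Prop :=
  forall (i : 'I_N) (B : set nat),
    P [set w | B (Y w i)] = poisson_prob (phi (site i)) 0%N B.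

End urn_process.

Arguments independent_coords {R N d T} P Y.
Arguments poisson_coords {R N d T} P phi Y.

(* Main.v *)
Require Import Defs.
From mathcomp Require Import all_boot all_order all_algebra.
From mathcomp Require Import all_classical all_reals all_analysis.
From mathcomp Require Import measurable_realfun.
From mathcomp Require Import ring lra zify.

(** The proof works with the backward equation and a maximum principle; it never
    looks at trajectories.

    Fix N. For bounded f, the function u(t, x) = E_x f(X_t) has, by the semigroup
    property, right derivative L u(t, .)(x) in t. The number of particles |x| has
    finite sublevel sets, and the 2 + eps0 moments of the offspring give the
    Lyapunov inequality L W <= c W for W(x) = (|x| + 1)^(2 + e), e = min(eps0, 1)
    ([branching_generator_weight]). Hence a maximum principle holds
    ([comparison_principle]). As W outgrows quadratic functions, one may compare
    with unbounded ones: for w and f of quadratic growth with f >= 0, if w solves w' >= L w (respectively w' <= L w) and w(0, .) >= f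
    (respectively <=), then w(t, x) is an upper (respectively lower) bound for
    E_x f(X_t) ([integral_le_supersolution], [integral_ge_subsolution]).

    The generator maps a linear function sum_l m_l x(l) to the linear function of
    vector A m, so E_x X_t(a) = sum_l m_l(t) x(l), where m' = A m and m(0) is the
    indicator of a ([mean_identity]). The off-diagonal entries of A are O(1/N) and
    its diagonal entries are bounded above, so 0 <= m_l(t) <= C (1_{l = a} + 1/N)
    on bounded time intervals ([mean_flow]). For the second moment with a <> b, the
    product of the two linear functions satisfies the backward equation up to a
    linear function of vector Gamma(t), and
    |Gamma_l(t)| <= C (1_{l = a} + 1/N) (1_{l = b} + 1/N)
    ([jump_covariance_profile_le]). Since A preserves this shape up to a factor, a
    growing exponential times this vector corrects the product into a super- and a
    subsolution. Thus, from a deterministic initial state x,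
    |Cov_x(X_t(a), X_t(b))| <= C sum_l x(l) (1_{l = a} + 1/N) (1_{l = b} + 1/N)
    ([second_moment_bounds]), and without the x(l) the sum is exactly 3/N.

    Finally the initial state is averaged ([covariance_mixture_le]). The
    conditional covariances contribute at most C/N because the initial means are
    bounded. The conditional means are linear functions of the initial state, whose
    coordinates are independent, so their covariance is
    sum_l m_l(t) m'_l(t) Var(X_0(l)), with m and m' the vectors of a and b; this is
    again at most C/N because the variances are bounded. *)

Set Implicit Arguments.
Unset Strict Implicit.
Unset Printing Implicit Defensive.

Import Order.TTheory GRing.Theory Num.Theory.
Import numFieldNormedType.Exports.

Local Open Scope classical_set_scope.
Local Open Scope ring_scope.

(** * Real series *)

Section real_series.
Context {R : realType}.
Implicit Types (u v : R^nat).

Lemma cvg_series_dominated u v :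
  (forall k, `|u k| <= v k) -> cvgn (series v) -> cvgn (series u).
Proof.
move=> uv cv; apply: normed_cvg; apply: series_le_cvg cv => //= k.
by rewrite (le_trans _ (uv k)).
Qed.

Lemma lim_series_ge0 u : (forall k, 0 <= u k) -> cvgn (series u) ->
  0 <= limn (series u).
Proof.
move=> u0 cu; apply: limr_ge => //; near=> n.
by rewrite /series/= sumr_ge0.
Unshelve. all: by end_near. Qed.

Lemma cvg_series_scale u c : cvgn (series u) -> cvgn (series (fun k => c * u k)).
Proof. by move=> cu; exact: (@is_cvg_seriesZ _ u c cu). Qed.

Lemma lim_series_scale u c : cvgn (series u) ->
  limn (series (fun k => c * u k)) = c * limn (series u).
Proof. by move=> cu; exact: (@lim_seriesZ _ u c cu). Qed.

Lemma cvg_series_add u v : cvgn (series u) -> cvgn (series v) ->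
  cvgn (series (fun k => u k + v k)).
Proof. by move=> cu cv; apply: is_cvg_seriesD. Qed.

Lemma lim_series_add u v : cvgn (series u) -> cvgn (series v) ->
  limn (series (fun k => u k + v k)) = limn (series u) + limn (series v).
Proof. by move=> cu cv; rewrite -lim_seriesD. Qed.

Lemma cvg_series_sum (I : Type) (s : seq I) (Q : pred I) (u : I -> R^nat) :
  (forall i, cvgn (series (u i))) ->
  cvgn (series (fun k => \sum_(i <- s | Q i) u i k)).
Proof.
move=> cu; elim: s => [|i s IH].
  under eq_fun do rewrite big_nil.
  apply: (cvg_series_dominated (v := fun=> 0)) => [k|]; first by rewrite normr0.
  by rewrite /series/=; under eq_fun do rewrite big1//; exact: is_cvg_cst.
under eq_fun do rewrite big_cons.
by case: (Q i) => //; apply: cvg_series_add.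
Qed.

Lemma lim_series_sum (I : Type) (s : seq I) (Q : pred I) (u : I -> R^nat) :
  (forall i, cvgn (series (u i))) ->
  limn (series (fun k => \sum_(i <- s | Q i) u i k)) =
  \sum_(i <- s | Q i) limn (series (u i)).
Proof.
move=> cu; elim: s => [|i s IH].
  under eq_fun do rewrite big_nil.
  rewrite big_nil /series/=; under eq_fun do rewrite big1//; exact: lim_cst.
under eq_fun do rewrite big_cons.
rewrite big_cons; case: (Q i) => //.
by rewrite (lim_series_add (cu i) (cvg_series_sum cu)) IH.
Qed.

Lemma lim_series_mono u v : (forall k, u k <= v k) ->
  cvgn (series u) -> cvgn (series v) -> limn (series u) <= limn (series v).
Proof. by move=> uv cu cv; apply: lim_series_le. Qed.

End real_series.

(** * The weight (n + 1)^(2 + e) *)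

Section weight.
Context {R : realType} (e : R).
Hypothesis e_gt0 : 0 < e.

(** The Lyapunov function of the process is [weight e] applied to the number of
    particles. The extra exponent [e] makes it dominate every quadratic function at
    infinity, while the jump rates still integrate it. The square is a separate
    factor, so that only the factor with exponent in ]0, 1] needs real powers. *)
Definition weight (n : nat) : R := n.+1%:R ^+ 2 * n.+1%:R `^ e.

Lemma powRS_ge1 n : 1 <= n.+1%:R `^ e :> R.
Proof.
have {1}-> : 1 = 1 `^ e :> R by rewrite powR1.
by rewrite ge0_ler_powR ?nnegrE ?ler1n// ltW.
Qed.

Lemma weight_ge_sqr n : n.+1%:R ^+ 2 <= weight n.
Proof. by rewrite /weight ler_peMr ?powRS_ge1// exprn_ge0. Qed.

Lemma weight_ge1 n : 1 <= weight n.
Proof. by rewrite (le_trans _ (weight_ge_sqr n))// exprn_ege1// ler1n. Qed.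

Lemma weight_ge0 n : 0 <= weight n.
Proof. exact: le_trans (weight_ge1 n). Qed.

Lemma weight_mono m n : (m <= n)%N -> weight m <= weight n.
Proof.
move=> mn; rewrite ler_pM ?exprn_ge0 ?powR_ge0//.
  by rewrite lerXn2r ?nnegrE// ler_nat.
by rewrite ge0_ler_powR ?nnegrE ?ler_nat// ltW.
Qed.

Lemma weightD m n : weight (m + n) <= weight m * weight n.
Proof.
apply: (@le_trans _ _ (weight (m.+1 * n.+1).-1)).
  by apply: weight_mono; rewrite mulSn mulnS /=; lia.
rewrite /weight prednK// natrM exprMn powRM// mulrACA.
by [].
Qed.

Hypothesis e_le1 : e <= 1.

(** The right-hand side loses one factor [n.+1] with respect to [weight e n]. As
    the total jump rate of a state with [n] particles is proportional to [n], this
    turns the increment bound into a bound by [weight e n] itself. The proof uses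
    (a + b)^e <= a^e (1 + b / a) on the leading term and the cruder
    (a + b)^e <= 2 a^e b^e on the others, with a = n + 1 and b = k + 1. *)
Lemma weight_incr n k : (0 < n)%N ->
  weight (n - 1 + k) - weight n <= 7 * (n.+1%:R * n.+1%:R `^ e) * weight k.
Proof.
move=> n0.
set a : R := n.+1%:R; set b : R := k.+1%:R.
have a1 : 1 <= a by rewrite ler1n.
have b1 : 1 <= b by rewrite ler1n.
have a0 : 0 <= a by lra.
have b0 : 0 <= b by lra.
have ab0 : 0 <= a * b by exact: mulr_ge0.
have ab : a + b <= 2 * (a * b) by nra.
have aeb : (a + b) `^ e <= 2 * (a `^ e * b `^ e).
  rewrite (@le_trans _ _ ((2 * (a * b)) `^ e))//.
    by rewrite ge0_ler_powR ?nnegrE ?(ltW e_gt0) ?addr_ge0 ?mulr_ge0.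
  rewrite powRM// powRM//.
  rewrite ler_wpM2r ?mulr_ge0 ?powR_ge0//.
  by rewrite -[leRHS]powRr1// ler_powR// ler1n.
have aeb' : (a + b) `^ e <= a `^ e * (1 + b / a).
  have -> : a + b = a * (1 + b / a) by rewrite mulrDr mulr1 mulrCA divff ?mulr1//; lra.
  have ba0 : 0 <= b / a by exact: divr_ge0.
  rewrite powRM ?addr_ge0//.
  rewrite ler_wpM2l ?powR_ge0//.
  have c1 : 1 <= 1 + b / a by rewrite lerDl.
  by rewrite -[leRHS]powRr1 ?ler_powR// addr_ge0.
have : weight (n - 1 + k) <= (a + b) ^+ 2 * (a + b) `^ e.
  rewrite -natrD; apply: (@le_trans _ _ (weight (n + k.+1))).
    by apply: weight_mono; lia.
  by rewrite /weight addSn.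
have abe0 : 0 <= (a + b) `^ e by rewrite powR_ge0.
have ae0 : 0 <= a `^ e by rewrite powR_ge0.
have be1 : 1 <= b `^ e by exact: powRS_ge1.
rewrite /weight -/a -/b => wle.
move: (weight (n - 1 + k)) wle => wn wle.
move: aeb aeb' abe0 ae0 be1 wle; move: ((a + b) `^ e) (a `^ e) (b `^ e) => X Y Z.
move=> XYZ XY X0 Y0 Z1 wle.
have H1 : a ^+ 2 * X <= a^+2 * Y + a * Y * b.
  have -> : a^+2 * Y + a * Y * b = a ^+ 2 * (Y * (1 + b / a)) by field; lra.
  by rewrite ler_wpM2l// exprn_ge0; lra.
have H2 : (2 * a * b + b^+2) * X <= 3 * a * b^+2 * (2 * (Y * Z)).
  apply: (@le_trans _ _ ((3 * a * b^+2) * X)).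
    rewrite ler_wpM2r//.
    rewrite -subr_ge0 (_ : _ - _ = 2 * (a * b * (b - 1)) + (a - 1) * b ^+ 2); last by ring.
    by rewrite addr_ge0 ?mulr_ge0 ?subr_ge0 ?exprn_ge0.
  by rewrite ler_wpM2l// !mulr_ge0// exprn_ge0.
have H3 : a * Y * b <= a * Y * (b^+2 * Z).
  rewrite ler_wpM2l//; first exact: mulr_ge0.
  rewrite (le_trans (y := b ^+ 2))//; first by rewrite expr2 ler_peMr.
  by rewrite ler_peMr// exprn_ge0.
lra.
Qed.
End weight.

Section weight_growth.
Context {R : realType} (e : R).

Lemma weight_dominates (C eps : R) : 0 < e -> 0 < eps ->
  exists n0, forall n, (n0 <= n)%N -> C * n.+1%:R ^+ 2 <= eps * weight e n.
Proof.
move=> e_gt0 eps0; pose A := `|C| / eps.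
have A0 : 0 <= A by rewrite divr_ge0// ltW.
exists (Num.truncn (A `^ e^-1)) => n n0n.
have An : A <= n.+1%:R `^ e.
  have -> : A = (A `^ e^-1) `^ e by rewrite -powRrM mulVf ?powRr1// gt_eqF.
  rewrite ge0_ler_powR ?nnegrE ?powR_ge0 ?(ltW e_gt0)//.
  by rewrite ltW// (lt_le_trans (truncnS_gt _))// ler_nat.
rewrite (mulrC C) /weight mulrCA ler_wpM2l ?exprn_ge0//.
rewrite (le_trans (ler_norm _))// -ler_pdivrMl// mulrC; exact: An.
Qed.

End weight_growth.

(** * Branching generators on finitely many urns *)

Section branching_generator.
Context {R : realType} {N : nat} (r : nat -> 'I_N -> 'I_N -> R) (e : R).
Implicit Types (x : urn_state N) (f g : urn_state N -> R).

Definition population x : nat := (\sum_(i < N) x i)%N.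

(** For an occupied urn [i], both kinds of moves of the urn process have this
    form: a particle leaves urn [i] and [k] particles enter urn [j], where [j] may
    be [i]. On an empty urn, where truncation matters, the rate is 0. *)
Definition branch k (i j : 'I_N) x : urn_state N :=
  [ffun l => (x l - (l == i) + k * (l == j))%N].

Definition branching_generator f x : R :=
  \sum_(i < N) \sum_(j < N)
    (x i)%:R * limn (series (fun k => r k i j * (f (branch k i j x) - f x))).

(** On this class of functions the series over the number of children converge,
    so the generator is linear there; it contains the Lyapunov function, all
    quadratic functions and all bounded functions. *)
Definition dominated f :=
  exists C : R, forall x, `|f x| <= C * weight e (population x).

Lemma population_branch_le k i j x :
  (population (branch k i j x) <= population x + k)%N.
Proof.
have -> : (population x + k = \sum_(l < N) (x l + k * (l == j)))%N.
  rewrite big_split/= -/(population x); congr addn.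
  rewrite (bigD1 j)//= eqxx muln1 big1 ?addn0// => l /negPf ->.
  by rewrite muln0.
apply: leq_sum => l _; rewrite ffunE; case: (l == i); case: (l == j); lia.
Qed.

Lemma population_branch k i j x : (0 < x i)%N ->
  population (branch k i j x) = (population x - 1 + k)%N.
Proof.
move=> xi; suff : (population (branch k i j x) + 1 = population x + k)%N.
  have : (0 < population x)%N by rewrite /population (bigD1 i)//=; lia.
  lia.
have -> : (population x + k = \sum_(l < N) (x l + k * (l == j)))%N.
  rewrite big_split/= -/(population x); congr addn.
  rewrite (bigD1 j)//= eqxx muln1 big1 ?addn0// => l /negPf ->.
  by rewrite muln0.
have -> : (1 = \sum_(l < N) (l == i))%N.
  by rewrite (bigD1 i)//= eqxx big1 ?addn0// => l /negPf ->.
rewrite -big_split/=; apply: eq_bigr => l _; rewrite ffunE.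
by case: (eqVneq l i) => [->|_]; case: (_ == j); lia.
Qed.

Hypotheses (e_gt0 : 0 < e) (e_le1 : e <= 1).
Hypothesis r_ge0 : forall k i j, 0 <= r k i j.
Hypothesis r_weight : forall i j, cvgn (series (fun k => r k i j * weight e k)).

Lemma dominated_lin a f b g : dominated f -> dominated g ->
  dominated (fun x => a * f x + b * g x).
Proof.
move=> [C fC] [D gD]; exists (`|a| * C + `|b| * D) => x.
rewrite (le_trans (ler_normD _ _))// !normrM mulrDl -!mulrA lerD//.
  by rewrite ler_wpM2l.
by rewrite ler_wpM2l.
Qed.

Lemma dominated_quadratic f (C : R) :
  (forall x, `|f x| <= C * (population x).+1%:R ^+ 2) -> dominated f.
Proof.
move=> fC; exists `|C| => x; rewrite (le_trans (fC x))//.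
rewrite (le_trans (ler_wpM2r _ (ler_norm C)))// ?exprn_ge0//.
by rewrite ler_wpM2l// weight_ge_sqr.
Qed.

Lemma dominated_bounded f (M : R) : (forall x, `|f x| <= M) -> dominated f.
Proof.
move=> fM; exists `|M| => x.
rewrite (le_trans (fM x))// (le_trans (ler_norm _))// ler_peMr//.
exact: weight_ge1.
Qed.

Lemma dominated_weight : dominated (fun x => weight e (population x)).
Proof. by exists 1 => x; rewrite mul1r ger0_norm// weight_ge0. Qed.

Lemma cvg_jump f i j x : dominated f ->
  cvgn (series (fun k => r k i j * (f (branch k i j x) - f x))).
Proof.
move=> [C fC].
have C0 : 0 <= C.
  have := le_trans (normr_ge0 _) (fC x).
  by rewrite pmulr_lge0// (lt_le_trans ltr01)// weight_ge1.
have cw : cvgn (series (fun k =>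
    2 * (C * weight e (population x)) * (r k i j * weight e k))).
  exact: cvg_series_scale.
apply: (cvg_series_dominated _ cw) => k.
rewrite normrM (ger0_norm (r_ge0 _ _ _)) mulrCA ler_wpM2l//.
rewrite (le_trans (ler_normB _ _))//.
have w0 := weight_ge0 e_gt0 (population x); have w1 := weight_ge1 e_gt0 k.
rewrite -mulrA mulr2n mulrDl mul1r -mulrA lerD//.
  rewrite (le_trans (fC _))// ler_wpM2l//.
  by rewrite (le_trans _ (weightD e_gt0 _ _))// weight_mono// population_branch_le.
by rewrite (le_trans (fC _))// ler_wpM2l// ler_peMr.
Qed.

Lemma branching_generator_lin a f b g x : dominated f -> dominated g ->
  branching_generator (fun y => a * f y + b * g y) x =
  a * branching_generator f x + b * branching_generator g x.
Proof.
move=> df dg; rewrite /branching_generator !mulr_sumr -big_split/=.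
apply: eq_bigr => i _; rewrite !mulr_sumr -big_split/=; apply: eq_bigr => j _.
rewrite (_ : (fun k => _) = (fun k =>
    a * (r k i j * (f (branch k i j x) - f x)) +
    b * (r k i j * (g (branch k i j x) - g x)))); last first.
  by apply/funext => k; ring.
rewrite lim_series_add; [|apply: cvg_series_scale; exact: cvg_jump..].
rewrite !lim_series_scale; [|exact: cvg_jump..].
ring.
Qed.

Lemma branching_generator_min f x : dominated f -> (forall y, f x <= f y) ->
  0 <= branching_generator f x.
Proof.
move=> df fx; apply: sumr_ge0 => i _; apply: sumr_ge0 => j _.
rewrite mulr_ge0// lim_series_ge0//; last exact: cvg_jump.
by move=> k; rewrite mulr_ge0// subr_ge0.
Qed.

Definition total_weighted_rate : R :=
  \sum_(i < N) \sum_(j < N) limn (series (fun k => r k i j * weight e k)).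

Lemma total_weighted_rate_ge0 : 0 <= total_weighted_rate.
Proof.
apply: sumr_ge0 => i _; apply: sumr_ge0 => j _; apply: lim_series_ge0 => // k.
by rewrite mulr_ge0// weight_ge0.
Qed.

(** The Lyapunov inequality: the growth of the weight along the generator is
    controlled by the weight, which rules out explosion quantitatively. *)
Lemma branching_generator_weight x :
  branching_generator (fun y => weight e (population y)) x <=
  7 * total_weighted_rate * weight e (population x).
Proof.
rewrite -mulrA mulrCA /total_weighted_rate mulr_suml ler_sum// => i _.
rewrite mulr_suml ler_sum// => j _.
have [->|xi] := posnP (x i).
  rewrite mul0r !mulr_ge0 ?weight_ge0// lim_series_ge0// => k.
  by rewrite mulr_ge0// weight_ge0.
have tx0 : (0 < population x)%N by rewrite /population (bigD1 i)//=; lia.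
set a : R := (population x).+1%:R.
apply: (@le_trans _ _ (a * (7 * (a * a `^ e) *
    limn (series (fun k => r k i j * weight e k))))).
  apply: (@le_trans _ _ ((x i)%:R * (7 * (a * a `^ e) *
    limn (series (fun k => r k i j * weight e k))))).
    rewrite ler_wpM2l// -lim_series_scale//; apply: lim_series_mono.
    - move=> k; rewrite mulrCA ler_wpM2l// population_branch//.
      exact: weight_incr.
    - exact: (@cvg_jump _ i j x dominated_weight).
    - exact: cvg_series_scale.
  rewrite ler_wpM2r//; last first.
    by rewrite ler_nat /population (bigD1 i)//=; lia.
  rewrite !mulr_ge0 ?powR_ge0// lim_series_ge0// => k.
  by rewrite mulr_ge0// weight_ge0.
rewrite le_eqVlt; apply/orP; left; apply/eqP; rewrite /weight -/a; ring.
Qed.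

End branching_generator.

(** * One-sided derivatives and first exit times *)

Lemma cvg_near_eq {R : realType} {T : Type} {F : set_system T} {FF : Filter F}
    (f g : T -> R) (l : R) :
  {near F, f =1 g} -> f @ F --> l -> g @ F --> l.
Proof. by move=> fg fl; exact: (cvg_trans (near_eq_cvg fg) fl). Qed.

Section right_derivative.
Context {R : realType}.
Implicit Types (g : R -> R) (t l : R).

Definition right_derivative g t l :=
  h^-1 * (g (t + h) - g t) @[h --> 0^'+] --> l.

Definition left_continuous g t := g (t - h) @[h --> 0^'+] --> g t.

Lemma right_derivative_lin a g l b g' l' t :
  right_derivative g t l -> right_derivative g' t l' ->
  right_derivative (fun s => a * g s + b * g' s) t (a * l + b * l').
Proof.
move=> gl gl'; rewrite /right_derivative (_ : (fun h => _) = (fun h =>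
    a * (h^-1 * (g (t + h) - g t)) + b * (h^-1 * (g' (t + h) - g' t)))).
  exact: (cvgD (@cvgMl_tmp _ _ _ _ _ a _ gl) (@cvgMl_tmp _ _ _ _ _ b _ gl')).
by apply/funext => h; ring.
Qed.

Lemma left_continuous_lin a g b g' t :
  left_continuous g t -> left_continuous g' t ->
  left_continuous (fun s => a * g s + b * g' s) t.
Proof.
move=> gt g't.
exact: (cvgD (@cvgMl_tmp _ _ _ _ _ a _ gt) (@cvgMl_tmp _ _ _ _ _ b _ g't)).
Qed.

Lemma right_derivative_continuous g t l : right_derivative g t l ->
  g (t + h) @[h --> 0^'+] --> g t.
Proof.
move=> gl; have h0 : (h : R) @[h --> 0^'+] --> (0 : R).
  exact: (@cvg_at_right_filter R R id 0 0 cvg_id).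
have : h * (h^-1 * (g (t + h) - g t)) + g t @[h --> 0^'+] --> 0 * l + g t.
  exact: (cvgD (cvgM h0 gl) (cvg_cst (g t))).
rewrite mul0r add0r => cg; apply: (cvg_near_eq _ cg).
near=> h; have h_gt0 : 0 < h by near: h; exact: nbhs_right_gt.
by rewrite /= mulrA divff ?gt_eqF// mul1r subrK.
Unshelve. all: by end_near. Qed.

(** One-sided notions suffice for the maximum principle, and they are all that the
    pointwise generator gives for the semigroup; explicit comparison functions are
    differentiable and enter through this lemma and the next one. *)
Lemma is_derive_right_derivative g t l : is_derive t 1 g l ->
  right_derivative g t l.
Proof.
move=> gl.
have : (h^-1 *: ((g \o shift t) (h *: (1 : R)) - g t)) @[h --> 0^'] --> l.
  by have /= := @derive_val _ _ _ _ _ _ _ gl; rewrite /derive => <-; exact: ex_derive.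
move=> /cvg_dnbhs_at_right cg; apply: (cvg_near_eq _ cg); near=> h.
by rewrite /= (_ : h *: 1 = h :> R) 1?[h + t]addrC//; exact: mulr1.
Unshelve. all: by end_near. Qed.

Lemma is_derive_left_continuous g t l : is_derive t 1 g l ->
  left_continuous g t.
Proof.
move=> gl; have gt : {for t, continuous g}.
  by apply: differentiable_continuous; apply/derivable1_diffP; exact: ex_derive.
have th : t - h @[h --> (0:R)^'+] --> t.
  have h0 : (h : R) @[h --> 0^'+] --> (0 : R).
    exact: (@cvg_at_right_filter R R id 0 0 cvg_id).
  by rewrite -[X in _ --> X](subr0 t); exact: (cvgB (cvg_cst t) h0).
exact: (@cvg_comp _ _ _ (fun h => t - h) g _ _ _ th gt).
Qed.

End right_derivative.

Section first_exit.
Context {R : realType} {S : Type} {I : finType} (emb : I -> S) (T : R)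
  (v : R -> S -> R) (D : R -> S -> R).
Hypothesis v_out : forall (t : R) x, 0 <= t <= T ->
  (forall i, x <> emb i) -> 0 <= v t x.
Hypothesis v_init : forall x, 0 <= v 0 x.
Hypothesis v_left : forall (t : R) x, 0 < t <= T -> left_continuous (v^~ x) t.
Hypothesis v_right : forall (t : R) x, 0 <= t < T -> right_derivative (v^~ x) t (D t x).
Hypothesis D_gt0 : forall (t : R) x, 0 <= t < T ->
  (forall y, 0 <= v t y) -> v t x = 0 -> 0 < D t x.

(** Let s be the supremum of the times up to which [v] has been nonnegative. By left
    continuity [v] is nonnegative at s. At each of the finitely many states [emb i],
    it is then either positive at s, hence just after s by right continuity, or zero
    at s with a positive right derivative. So s is the final time. *)
Lemma first_exit_ge0 (t : R) x : 0 <= t <= T -> 0 <= v t x.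
Proof.
move=> tT0; have T0 : 0 <= T by case/andP: tT0; exact: le_trans.
pose A := [set s : R | 0 <= s <= T /\ forall (r : R) y, 0 <= r <= s -> 0 <= v r y].
suff AT : A T by apply: AT.2.
have A0 : A 0.
  split; first by rewrite lexx.
  by move=> r y r0; have -> : r = 0 by apply/le_anti; rewrite andbC.
have hA : has_sup A by split; [exists 0|exists T => s [/andP[]]].
pose s := sup A.
have s0 : 0 <= s by apply: sup_upper_bound.
have sT : s <= T by apply: ge_sup; [exists 0|move=> r [/andP[]]].
have lts (r : R) y : 0 <= r < s -> 0 <= v r y.
  move=> /andP[r0 rs]; have [a [_ Aa] ra] := sup_gt hA.1 rs.
  by apply: Aa; rewrite r0 ltW.
have As : A s.
  split; first by rewrite s0.
  move=> r y /andP[r0]; rewrite le_eqVlt => /predU1P[->|rs]; last by rewrite lts// r0.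
  move: (s0); rewrite le_eqVlt => /predU1P[<-//|s_gt0].
  have sl := @v_left s y (introT andP (conj s_gt0 sT)).
  rewrite -(cvg_lim _ sl)//; apply: limr_ge; first by apply/cvg_ex; exists (v s y).
  near=> h; apply: lts.
  have h0 : 0 < h by near: h; exact: nbhs_right_gt.
  have hs : h <= s by near: h; exact: nbhs_right_le.
  by rewrite subr_ge0 hs ltrBlDr ltrDl.
have [->//|sNT] := eqVneq T s.
have s_ltT : s < T by rewrite lt_neqAle eq_sym sNT.
have vs y : 0 <= v s y by apply: As.2; rewrite lexx s0.
have [d d0 dP] : exists2 d, 0 < d & forall h y, 0 <= h <= d -> 0 <= v (s + h) y.
  have : \forall h \near 0^'+, forall i, 0 <= v (s + h) (emb i).
    apply: filter_forall => i.
    have sd : 0 <= s < T by rewrite s0.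
    have := @v_right s (emb i) sd.
    have := vs (emb i); rewrite le_eqVlt => /predU1P[v0|v_gt0] dv.
      have D0 := @D_gt0 s _ sd vs (esym v0).
      near=> h; have h0 : 0 < h by near: h; exact: nbhs_right_gt.
      have : 0 < h^-1 * (v (s + h) (emb i) - v s (emb i)).
        by near: h; exact: cvgr_gt dv _ D0.
      by rewrite -v0 subr0 pmulr_rgt0 ?invr_gt0// => /ltW.
    near=> h; apply: ltW; near: h.
    exact: cvgr_gt (right_derivative_continuous dv) _ v_gt0.
  move=> [e /= e_gt0 he]; exists (Num.min (e / 2) (T - s)).
    by rewrite lt_min divr_gt0// subr_gt0.
  move=> h y /andP[h0]; rewrite le_min => /andP[he2 hT].
  move: h0; rewrite le_eqVlt => /predU1P[<-|h0]; first by rewrite addr0.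
  have [[i ->]|ny] := pselect (exists i, y = emb i).
    apply: he => //=; rewrite sub0r normrN gtr0_norm// (le_lt_trans he2)//.
    by rewrite ltr_pdivrMr// ltr_pMr// ltr1n.
  apply: v_out => [|i yi]; last by apply: ny; exists i.
  by rewrite addr_ge0 ?(ltW h0)//= addrC -lerBrDr.
have : A (s + Num.min d (T - s)).
  split.
    by rewrite addr_ge0 ?le_min ?(ltW d0) ?subr_ge0//= -lerBrDl ge_min lexx orbT.
  move=> r y /andP[r0 rle]; have [rs|sr] := leP r s.
    by apply: As.2; rewrite r0.
  rewrite -(subrKC s r) dP// subr_ge0 (ltW sr)/=.
  by move: rle; rewrite -lerBlDl le_min => /andP[].
move=> /(sup_upper_bound hA); rewrite -/s.
by rewrite gerDl leNgt lt_min d0 subr_gt0 s_ltT.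
Unshelve. all: by end_near. Qed.
End first_exit.

(** * Comparison principle for branching generators *)

Section comparison.
Context {R : realType} {N : nat} (r : nat -> 'I_N -> 'I_N -> R) (e : R).
Hypotheses (e_gt0 : 0 < e) (e_le1 : e <= 1).
Hypothesis r_ge0 : forall k i j, 0 <= r k i j.
Hypothesis r_weight : forall i j, cvgn (series (fun k => r k i j * weight e k)).
Local Notation L := (branching_generator r).

(** Parabolic maximum principle. The state space is infinite, so a minimum need not
    be attained; adding a small multiple of exp(c t) times the weight repairs this,
    because the sum is positive outside a finite set of states. With c one more than
    the constant of the Lyapunov inequality, the added term is a strict
    supersolution, so the sum strictly increases wherever it vanishes at its
    minimum. *)
Lemma comparison_principle (T C : R) (v D : R -> urn_state N -> R) :
  (forall t : R, 0 <= t < T -> dominated e (v t)) ->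
  (forall (t : R) (x : urn_state N), 0 <= t <= T ->
    - (C * (population x).+1%:R ^+ 2) <= v t x) ->
  (forall x : urn_state N, 0 <= v 0 x) ->
  (forall (t : R) (x : urn_state N), 0 < t <= T -> left_continuous (v^~ x) t) ->
  (forall (t : R) (x : urn_state N), 0 <= t < T ->
    right_derivative (v^~ x) t (D t x)) ->
  (forall (t : R) (x : urn_state N), 0 <= t < T -> L (v t) x <= D t x) ->
  forall (t : R) (x : urn_state N), 0 <= t <= T -> 0 <= v t x.
Proof.
move=> vdom vC v0 vl vr vD t x tT.
pose W (y : urn_state N) := weight e (population y).
(* The additional 1 makes exp(c t) times the weight a strict supersolution. *)
pose c := 7 * total_weighted_rate r e + 1.
have W1 y : 1 <= W y by exact: weight_ge1.
have W0 y : 0 < W y by exact: lt_le_trans (W1 y).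
have rate0 := total_weighted_rate_ge0 e_gt0 r_ge0 r_weight.
have c0 : 0 <= c by rewrite addr_ge0// mulr_ge0.
suff main eps : 0 < eps -> 0 <= v t x + eps * W x * expR (c * t).
  apply/ler_addgt0Pr => d d0.
  have We : 0 < W x * expR (c * t) by rewrite mulr_gt0// expR_gt0.
  have := main (d / (W x * expR (c * t))) (divr_gt0 d0 We).
  by rewrite -[d / _ * W x * _]mulrA divfK ?gt_eqF.
move=> eps0.
have [n0 n0P] := weight_dominates C e_gt0 eps0.
pose emb (y : {ffun 'I_N -> 'I_n0.+1}) : urn_state N := [ffun i => nat_of_ord (y i)].
pose u s y := 1 * v s y + eps * W y * expR (c * s).
pose Du s y := 1 * D s y + eps * W y * (c * expR (c * s)).
suff : 0 <= u t x by rewrite /u mul1r.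
have expD (s : R) : is_derive s 1 (fun s => expR (c * s)) (c * expR (c * s)).
  apply: is_derive_eq; rewrite /GRing.scale/= ?mulr1 ?scaler0 ?addr0 ?add0r.
  by rewrite mulrC.
apply: (@first_exit_ge0 _ _ _ emb T u Du) => //.
- move=> s y sT yN; have e1 : 1 <= expR (c * s).
    by rewrite -expR0 ler_expR mulr_ge0//; case/andP: sT.
  have n0y : (n0 <= population y)%N.
    rewrite leqNgt; apply/negP => yn0.
    have yi i : (y i < n0.+1)%N.
      by rewrite ltnS (leq_trans _ (ltnW yn0))// /population (bigD1 i)//= leq_addr.
    apply: (yN [ffun i => Ordinal (yi i)]).
    by apply/ffunP => i; rewrite !ffunE.
  have := n0P _ n0y; have := vC s y sT; rewrite -/(W y) /u mul1r.
  have : eps * W y <= eps * W y * expR (c * s) by rewrite ler_peMr// mulr_ge0 ?ltW.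
  lra.
- move=> y; rewrite /u addr_ge0 ?mul1r// mulr_ge0 ?expR_ge0// mulr_ge0 ?ltW//.
- move=> s y sT; apply: left_continuous_lin; first exact: vl.
  exact: is_derive_left_continuous (expD s).
- move=> s y sT; apply: right_derivative_lin; first exact: vr.
  exact: is_derive_right_derivative (expD s).
move=> s y sT us us0.
have udom : dominated e (u s).
  rewrite (_ : u s = fun y => 1 * v s y + (eps * expR (c * s)) * W y).
    by apply: dominated_lin; [exact: vdom|exact: dominated_weight].
  by apply/funext => z; rewrite /u; ring.
have := branching_generator_min e_gt0 r_ge0 r_weight udom (x := y).
rewrite us0 => /(_ us).
rewrite (_ : u s = fun y => 1 * v s y + (eps * expR (c * s)) * W y); last first.
  by apply/funext => z; rewrite /u; ring.
rewrite (branching_generator_lin e_gt0)//; [|exact: vdom|exact: dominated_weight].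
have := branching_generator_weight e_gt0 e_le1 r_ge0 r_weight y.
rewrite -/W -/(W y) => LW.
have E0 := expR_gt0 (c * s).
have := vD s y sT; rewrite /Du; have := W0 y; move: LW.
have -> : total_weighted_rate r e = (c - 1) / 7 by rewrite /c; field.
move: (L W y) (L (v s) y) (D s y) (W y) (expR _) E0 => LWy Lv Dy Wy E E0 LW Wy0 LvD L0.
have : eps * E * LWy <= eps * E * ((c - 1) * Wy).
  have eE0 : 0 <= eps * E by rewrite mulr_ge0// ltW.
  rewrite ler_wpM2l//.
  by rewrite (le_trans LW)// (_ : 7 * ((c - 1) / 7) = c - 1)//; field.
have : 0 < eps * E * Wy by rewrite !mulr_gt0.
have -> : eps * Wy * (c * E) = eps * E * ((c - 1) * Wy) + eps * E * Wy by ring.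
lra.
Qed.

End comparison.

(** * Integrals over the countable state space *)

Lemma measurable_fun_urn {N : nat} {d} {Y : sigmaRingType d}
  (D : set (urn_state N)) (f : urn_state N -> Y) : measurable_fun D f.
Proof. by move=> _ B _; exact: I. Qed.

Section discrete_integral.
Context {R : realType} {N : nat}.
Local Open Scope ereal_scope.
Local Notation S := (urn_state N).

(** Every singleton is exactly one cell; making the other cells empty turns the
    family into a partition indexed by nat, as countable additivity wants it. *)
Definition cell (n : nat) : set S :=
  if @pickle_inv {ffun 'I_N -> nat} n is Some y then [set y : S] else set0.

Definition cell_value (f : S -> \bar R) (n : nat) : \bar R :=
  if @pickle_inv {ffun 'I_N -> nat} n is Some y then f y else 0.

Lemma bigcup_cell : \bigcup_n cell n = [set: S].
Proof.
apply/seteqP; split=> // y _; exists (@pickle {ffun 'I_N -> nat} y) => //.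
by rewrite /cell pickleK_inv.
Qed.

Lemma trivIset_cell : trivIset setT cell.
Proof.
apply/trivIsetP => m n _ _ mn; apply/seteqP; split=> // y [].
rewrite /cell; case Em : (pickle_inv m) => [u|//] /= ->.
case En : (pickle_inv n) => [w|//] /= uw; move: mn.
have := @pickle_invK {ffun 'I_N -> nat} m; have := @pickle_invK {ffun 'I_N -> nat} n.
by rewrite Em En /= uw => -> ->; rewrite eqxx.
Qed.

Lemma ge0_integral_cell (mu : {measure set S -> \bar R}) (f : S -> \bar R) :
  (forall y, 0 <= f y) ->
  \int[mu]_y f y = \sum_(n <oo) cell_value f n * mu (cell n).
Proof.
move=> f0; rewrite -bigcup_cell ge0_integral_bigcup//; last exact: trivIset_cell.
apply: eq_eseriesr => n _; rewrite /cell_value /cell.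
case: (pickle_inv n) => [y|]; last by rewrite integral_set0 mul0e.
rewrite -integral_cst//; apply: eq_integral => z; rewrite inE => /= ->//.
Qed.

(** The Chapman-Kolmogorov equation and the Markov property describe mixtures of
    kernels on events; this passes from events to nonnegative functions, by expanding
    the integral over the countable state space. *)
Lemma integral_mixture {d} {Y : measurableType d} (mu : {measure set Y -> \bar R})
    (k : Y -> {measure set S -> \bar R}) (nu : {measure set S -> \bar R})
    (f : S -> \bar R) :
  (forall B, measurable_fun [set: Y] (k ^~ B)) ->
  (forall B, nu B = \int[mu]_y k y B) ->
  (forall z, 0 <= f z) ->
  \int[nu]_z f z = \int[mu]_y (\int[k y]_z f z).
Proof.
move=> mk nuE f0.
have c0 n : 0 <= cell_value f n by rewrite /cell_value; case: pickle_inv.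
rewrite ge0_integral_cell//.
under [in RHS]eq_integral do rewrite ge0_integral_cell//.
rewrite integral_nneseries//.
- apply: eq_eseriesr => n _; rewrite nuE ge0_integralZl//.
- by move=> n; apply: emeasurable_funM => //; exact: measurable_cst.
- by move=> n y _; rewrite mule_ge0.
Qed.

End discrete_integral.

(** * Backward equation for the transition semigroup *)

Section semigroup.
Context {R : realType} {N : nat}.
Local Notation S := (urn_state N).
Context (p : R -> R.-pker S ~> S) (G : (S -> R) -> S -> R).
Hypotheses (p_semigroup : transition_semigroup p)
  (p_generator : has_generator p G).

Definition kernel_mean (t : R) (f : S -> R) (x : S) : R := \int[p t x]_y f y.

Lemma integrable_bounded t x (f : S -> R) (M : R) :
  (forall y, `|f y| <= M) -> (p t x).-integrable setT (EFin \o f).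
Proof.
move=> fM; apply: (@le_integrable _ _ _ _ _ _ _ (EFin \o cst M)) => //.
- by move=> y _ /=; rewrite lee_fin (le_trans (fM y))// ler_norm.
apply/integrableP; split=> //.
rewrite (_ : (fun _ => _) = cst (`|M|%:E))//.
by rewrite integral_cst// prob_kernel mule1 ltry.
Qed.

Lemma kernel_meanE t x (f : S -> R) (M : R) : (forall y, `|f y| <= M) ->
  (kernel_mean t f x)%:E = (\int[p t x]_y (f y)%:E)%E.
Proof.
move=> fM; rewrite fineK//; apply: integrable_fin_num => //.
exact: integrable_bounded fM.
Qed.

Lemma kernel_mean_le t x (f g : S -> R) (M : R) :
  (forall y, `|f y| <= M) -> (forall y, `|g y| <= M) ->
  (forall y, f y <= g y) -> kernel_mean t f x <= kernel_mean t g x.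
Proof.
move=> fM gM fg; apply: le_Rintegral => //.
  exact: integrable_bounded fM.
exact: integrable_bounded gM.
Qed.

Lemma kernel_mean_cst t x c : kernel_mean t (fun=> c) x = c.
Proof. by rewrite /kernel_mean Rintegral_cst// prob_kernel mulr1. Qed.

Lemma kernel_mean_lin t x a (f : S -> R) b (g : S -> R) (M : R) :
  (forall y, `|f y| <= M) -> (forall y, `|g y| <= M) ->
  kernel_mean t (fun y => a * f y + b * g y) x =
  a * kernel_mean t f x + b * kernel_mean t g x.
Proof.
move=> fM gM.
have i1 := integrable_bounded t x fM; have i2 := integrable_bounded t x gM.
rewrite /kernel_mean RintegralD//.
- by rewrite !RintegralZl.
- by apply: (@integrable_bounded _ _ _ (`|a| * M)) => y; rewrite normrM ler_wpM2l.
- by apply: (@integrable_bounded _ _ _ (`|b| * M)) => y; rewrite normrM ler_wpM2l.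
Qed.

Lemma kernel_mean_scale t x a (f : S -> R) (M : R) : (forall y, `|f y| <= M) ->
  kernel_mean t (fun y => a * f y) x = a * kernel_mean t f x.
Proof.
by move=> fM; rewrite /kernel_mean RintegralZl//; exact: integrable_bounded fM.
Qed.

Lemma kernel_mean_norm t x (f : S -> R) (M : R) : (forall y, `|f y| <= M) ->
  `|kernel_mean t f x| <= M.
Proof.
move=> fM; have cM (y : S) : `|M| <= `|M| by [].
have NM (y : S) : `| - M| <= `|M| by rewrite normrN.
have fM' y : `|f y| <= `|M| by rewrite (le_trans (fM y))// ler_norm.
rewrite ler_norml -{1}(kernel_mean_cst t x (- M)) -{2}(kernel_mean_cst t x M).
apply/andP; split; apply: (@kernel_mean_le _ _ _ _ `|M|) => // y.
  by have := fM y; rewrite ler_norml => /andP[].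
by have := fM y; rewrite ler_norml => /andP[].
Qed.

Lemma kernel_mean0 x (f : S -> R) (M : R) : (forall y, `|f y| <= M) ->
  kernel_mean 0 f x = f x.
Proof.
move=> fM; rewrite /kernel_mean /Rintegral.
rewrite (@eq_measure_integral _ _ _ _ \d_x)//.
  by rewrite integral_dirac// diracT mul1e.
by move=> A mA _; exact: semigroup0.
Qed.

Lemma kernel_meanD s t x (f : S -> R) (M : R) : 0 <= s -> 0 <= t ->
  (forall y, 0 <= f y <= M) ->
  kernel_mean (s + t) f x = kernel_mean s (kernel_mean t f) x.
Proof.
move=> s0 t0 f0M.
have fM y : `|f y| <= M by have /andP[f0 ?] := f0M y; rewrite ger0_norm.
apply: EFin_inj; rewrite (kernel_meanE _ _ fM).
rewrite (@kernel_meanE _ _ _ M); last by move=> y; exact: kernel_mean_norm.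
rewrite (integral_mixture (mu := p s x) (k := p t)).
- by apply: eq_integral => y _; rewrite -(kernel_meanE _ _ fM).
- by move=> B; exact: measurable_fun_urn.
- by move=> B; exact: semigroupD.
- by move=> y; rewrite lee_fin; case/andP: (f0M y).
Qed.

Lemma bounded_by (f : S -> R) (M : R) : (forall y, `|f y| <= M) -> bounded_fun f.
Proof.
move=> fM; exists M; split; first exact: num_real.
by move=> M' MM' y _; exact: le_trans (fM y) (ltW MM').
Qed.

(** Backward equation: since [kernel_mean (t + h) f] is [kernel_mean h] applied to
    the bounded function [kernel_mean t f], the right derivative at time t is the
    right derivative at time 0 for another bounded function, that is, its
    generator. *)
Lemma kernel_mean_right_derivative t x (f : S -> R) (M : R) : 0 <= t ->
  (forall y, 0 <= f y <= M) ->
  right_derivative (fun s => kernel_mean s f x) t (G (kernel_mean t f) x).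
Proof.
move=> t0 f0M.
have fM y : `|f y| <= M by have /andP[f0 ?] := f0M y; rewrite ger0_norm.
have fmM y : `|kernel_mean t f y| <= M by exact: kernel_mean_norm.
have := @p_generator _ (@measurable_fun_urn _ _ _ setT (kernel_mean t f))
  (bounded_by fmM) x.
apply: cvg_near_eq; near=> h.
have h0 : 0 < h by near: h; exact: nbhs_right_gt.
by rewrite [t + h]addrC (kernel_meanD x (ltW h0) t0 f0M).
Unshelve. all: by end_near. Qed.

Definition point_mass (x y : S) : R := (y == x)%:R.

Lemma point_mass_norm x y : `|point_mass x y| <= 1.
Proof. by rewrite /point_mass; case: (y == x); rewrite ?normr1// normr0. Qed.

(** Otherwise the difference quotient of this probability could not converge. *)
Lemma kernel_stays x : kernel_mean h (point_mass x) x @[h --> 0^'+] --> (1 : R).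
Proof.
have := @p_generator _ (@measurable_fun_urn _ _ _ setT (point_mass x))
  (bounded_by (point_mass_norm x)) x.
rewrite (_ : point_mass x x = 1); last by rewrite /point_mass eqxx.
move=> c; have h0 : (h : R) @[h --> 0^'+] --> (0 : R).
  exact: (@cvg_at_right_filter R R id 0 0 cvg_id).
have : h * (h^-1 * (kernel_mean h (point_mass x) x - 1)) + 1
    @[h --> 0^'+] --> 0 * G (point_mass x) x + 1.
  exact: (cvgD (cvgM h0 c) (cvg_cst (1 : R))).
rewrite mul0r add0r; apply: cvg_near_eq; near=> h.
have hgt0 : 0 < h by near: h; exact: nbhs_right_gt.
by rewrite mulrA divff ?gt_eqF// mul1r subrK.
Unshelve. all: by end_near. Qed.

(** The function [kernel_mean t f] is obtained from g = [kernel_mean (t - h) f] by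
    running the process for a time h. As 0 <= g <= M, averaging g changes its value
    at x by at most M times the probability of having left x, uniformly in g. *)
Lemma kernel_mean_left_continuous t x (f : S -> R) (M : R) : 0 < t ->
  (forall y, 0 <= f y <= M) -> left_continuous (fun s => kernel_mean s f x) t.
Proof.
move=> t0 f0M.
have fM y : `|f y| <= M by have /andP[f0 ?] := f0M y; rewrite ger0_norm.
pose q h := kernel_mean h (point_mass x) x.
have qM := point_mass_norm x.
have : M * (1 - q h) @[h --> 0^'+] --> M * (1 - 1).
  exact: (@cvgMl_tmp _ _ _ _ _ M _ (cvgB (cvg_cst (1 : R)) (kernel_stays x))).
rewrite subrr mulr0 => qto0.
apply/cvgrPdist_le => eps eps0; near=> h.
have h0 : 0 < h by near: h; exact: nbhs_right_gt.
have ht : h <= t by near: h; exact: nbhs_right_le.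
have qe : M * (1 - q h) <= eps by near: h; exact: (cvgr_le _ qto0).
pose g := kernel_mean (t - h) f.
have M0 : 0 <= M by rewrite (le_trans _ (fM x)).
have g0M y : 0 <= g y <= M.
  have gM := kernel_mean_norm (t - h) y fM.
  apply/andP; split; last by rewrite (le_trans (ler_norm _)).
  by apply: Rintegral_ge0 => z _; case/andP: (f0M z).
have gM y : `|g y| <= M by have /andP[? ?] := g0M y; rewrite ger0_norm.
have -> : kernel_mean t f x = kernel_mean h g x.
  by rewrite -[in LHS](subrKC h t) (kernel_meanD x (ltW h0) _ f0M)// subr_ge0.
have /andP[gx0 gxM] := g0M x.
have bM a (y : S) : 0 <= a <= M -> `|a * point_mass x y| <= M.
  move=> /andP[a0 aM]; rewrite normrM ger0_norm// (le_trans _ aM)//.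
  by rewrite ler_piMr.
(* Both bounds keep only the contribution of the mass still at x: of g for
   the lower bound, of M - g for the upper bound. *)
have lo : g x * q h <= kernel_mean h g x.
  rewrite -(kernel_mean_scale _ _ _ qM).
  apply: (@kernel_mean_le _ _ _ _ M) => // y; first by rewrite bM// gx0.
  rewrite /point_mass; case: eqP => [->|_]; rewrite ?mulr1 ?mulr0//.
  by case/andP: (g0M y).
have hi : (M - g x) * q h <= M - kernel_mean h g x.
  rewrite -(kernel_mean_scale _ _ _ qM).
  have <- : kernel_mean h (fun y => 1 * M + (-1) * g y) x = M - kernel_mean h g x.
    rewrite (kernel_mean_lin _ _ _ _ _ gM) ?kernel_mean_cst ?mul1r ?mulN1r//.
    by move=> _; rewrite ger0_norm.
  apply: (@kernel_mean_le _ _ _ _ M) => y.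
  - by rewrite bM// subr_ge0 gxM lerBlDr lerDl.
  - rewrite mul1r mulN1r; have /andP[? ?] := g0M y.
    by rewrite ger0_norm ?subr_ge0// lerBlDr lerDl.
  - rewrite mul1r mulN1r /point_mass; case: eqP => [->|_]; rewrite ?mulr1 ?mulr0//.
    by rewrite subr_ge0; case/andP: (g0M y).
rewrite ler_norml; move: lo hi qe; rewrite -/g.
have q1 : q h <= 1.
  rewrite -(kernel_mean_cst h x 1); apply: (@kernel_mean_le _ _ _ _ 1) => // y.
  - by rewrite normr1.
  - by rewrite (le_trans (ler_norm _))// point_mass_norm.
move: (kernel_mean h g x) (q h) q1 (g x) gx0 gxM => K Q q1 gx gx0 gxM lo hi qe.
nra.
Unshelve. all: by end_near. Qed.

End semigroup.

(** * Moments squeezed between sub- and supersolutions *)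

Section sandwich.
Context {R : realType} {N : nat} (r : nat -> 'I_N -> 'I_N -> R) (e : R).
Hypotheses (e_gt0 : 0 < e) (e_le1 : e <= 1).
Hypothesis r_ge0 : forall k i j, 0 <= r k i j.
Hypothesis r_weight : forall i j, cvgn (series (fun k => r k i j * weight e k)).
Local Notation S := (urn_state N).
Local Notation L := (branching_generator r).
Context (p : R -> R.-pker S ~> S) (G : (S -> R) -> S -> R).
Hypotheses (p_semigroup : transition_semigroup p)
  (p_generator : has_generator p G).
Hypothesis G_L : forall (f : S -> R) x, dominated e f -> G f x = L f x.
Context (T : R) (w w' : R -> S -> R).
Hypothesis w_deriv : forall (t : R) (x : S), is_derive t 1 (w^~ x) (w' t x).
Hypothesis w_dom : forall t : R, 0 <= t <= T -> dominated e (w t).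

Lemma kernel_mean_dominated t (f : S -> R) (M : R) :
  (forall y, 0 <= f y <= M) -> dominated e (kernel_mean p t f).
Proof.
move=> f0M; apply: (@dominated_bounded _ _ _ e_gt0 _ M) => x.
by apply: kernel_mean_norm => y; have /andP[? ?] := f0M y; rewrite ger0_norm.
Qed.

(** The difference of a supersolution and of the semigroup is a supersolution, and
    a bounded [f] makes it bounded below by a quadratic function. *)
Lemma kernel_mean_le_supersolution (C M : R) (f : S -> R) :
  (forall y, 0 <= f y <= M) ->
  (forall (t : R) (x : S), 0 <= t <= T -> - (C * (population x).+1%:R ^+ 2) <= w t x) ->
  (forall x, f x <= w 0 x) ->
  (forall (t : R) (x : S), 0 <= t < T -> L (w t) x <= w' t x) ->
  forall (t : R) (x : S), 0 <= t <= T -> kernel_mean p t f x <= w t x.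
Proof.
move=> f0M wC fw0 Lw t x tT.
have fM y : `|f y| <= M by have /andP[? ?] := f0M y; rewrite ger0_norm.
have M0 : 0 <= M by rewrite (le_trans _ (fM x)).
pose v s y := 1 * w s y + (-1) * kernel_mean p s f y.
suff : 0 <= v t x by rewrite /v mul1r mulN1r subr_ge0.
have LT (s : R) : 0 <= s < T -> 0 <= s <= T by move=> /andP[-> /ltW].
apply: (@comparison_principle _ _ r e e_gt0 e_le1 r_ge0 r_weight T (C + M) v
  (fun s y => 1 * w' s y + (-1) * L (kernel_mean p s f) y)) => //.
- move=> s sT; apply: dominated_lin; first exact/w_dom/LT.
  exact: kernel_mean_dominated f0M.
- move=> s y sT; rewrite /v mul1r mulN1r mulrDl opprD lerD ?wC// lerN2.
  rewrite (le_trans (ler_norm _))// (le_trans (kernel_mean_norm _ _ _ fM))//.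
  by rewrite ler_peMr// exprn_ege1// ler1n.
- by move=> y; rewrite /v mul1r mulN1r (kernel_mean0 p_semigroup _ fM) subr_ge0.
- move=> s y /andP[s0 sT]; apply: left_continuous_lin.
    exact: is_derive_left_continuous (w_deriv s y).
  exact: (@kernel_mean_left_continuous _ _ _ _ p_semigroup p_generator s y f M s0 f0M).
- move=> s y /andP[s0 sT]; apply: right_derivative_lin.
    exact: is_derive_right_derivative (w_deriv s y).
  rewrite -G_L; last exact: kernel_mean_dominated f0M.
  exact: (@kernel_mean_right_derivative _ _ _ _ p_semigroup p_generator s y f M s0 f0M).
- move=> s y sT; rewrite (branching_generator_lin e_gt0)//.
  + by rewrite !mul1r lerD2r Lw.
  + exact/w_dom/LT.
  + exact: kernel_mean_dominated f0M.
Qed.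

Lemma kernel_mean_ge_subsolution (C M : R) (f : S -> R) :
  (forall y, 0 <= f y <= M) ->
  (forall (t : R) (x : S), 0 <= t <= T -> w t x <= C * (population x).+1%:R ^+ 2) ->
  (forall x, w 0 x <= f x) ->
  (forall (t : R) (x : S), 0 <= t < T -> w' t x <= L (w t) x) ->
  forall (t : R) (x : S), 0 <= t <= T -> w t x <= kernel_mean p t f x.
Proof.
move=> f0M wC fw0 Lw t x tT.
have fM y : `|f y| <= M by have /andP[? ?] := f0M y; rewrite ger0_norm.
have M0 : 0 <= M by rewrite (le_trans _ (fM x)).
pose v s y := 1 * kernel_mean p s f y + (-1) * w s y.
suff : 0 <= v t x by rewrite /v mul1r mulN1r subr_ge0.
have LT (s : R) : 0 <= s < T -> 0 <= s <= T by move=> /andP[-> /ltW].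
apply: (@comparison_principle _ _ r e e_gt0 e_le1 r_ge0 r_weight T C v
  (fun s y => 1 * L (kernel_mean p s f) y + (-1) * w' s y)) => //.
- move=> s sT; apply: dominated_lin; last exact/w_dom/LT.
  exact: kernel_mean_dominated f0M.
- move=> s y sT; rewrite /v mul1r mulN1r -[leLHS]add0r lerD ?lerN2 ?wC//.
  by apply: Rintegral_ge0 => z _; case/andP: (f0M z).
- by move=> y; rewrite /v mul1r mulN1r (kernel_mean0 p_semigroup _ fM) subr_ge0.
- move=> s y /andP[s0 sT]; apply: left_continuous_lin.
    exact: (@kernel_mean_left_continuous _ _ _ _ p_semigroup p_generator s y f M s0 f0M).
  exact: is_derive_left_continuous (w_deriv s y).
- move=> s y /andP[s0 sT]; apply: right_derivative_lin.
    rewrite -G_L; last exact: kernel_mean_dominated f0M.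
    exact: (@kernel_mean_right_derivative _ _ _ _ p_semigroup p_generator s y f M s0 f0M).
  exact: is_derive_right_derivative (w_deriv s y).
- move=> s y sT; rewrite (branching_generator_lin e_gt0)//.
  + by rewrite !mulN1r lerD2l lerN2 Lw.
  + exact: kernel_mean_dominated f0M.
  + exact/w_dom/LT.
Qed.

End sandwich.

Section moment_sandwich.
Context {R : realType} {N : nat} (r : nat -> 'I_N -> 'I_N -> R) (e : R).
Hypotheses (e_gt0 : 0 < e) (e_le1 : e <= 1).
Hypothesis r_ge0 : forall k i j, 0 <= r k i j.
Hypothesis r_weight : forall i j, cvgn (series (fun k => r k i j * weight e k)).
Local Notation S := (urn_state N).
Local Notation L := (branching_generator r).
Context (p : R -> R.-pker S ~> S) (G : (S -> R) -> S -> R).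
Hypotheses (p_semigroup : transition_semigroup p)
  (p_generator : has_generator p G).
Hypothesis G_L : forall (f : S -> R) x, dominated e f -> G f x = L f x.
Context (T C : R) (f : S -> R) (w w' : R -> S -> R).
Hypothesis w_deriv : forall (t : R) (x : S), is_derive t 1 (w^~ x) (w' t x).
Hypothesis w_quad : forall (t : R) (x : S), 0 <= t <= T ->
  `|w t x| <= C * (population x).+1%:R ^+ 2.
Hypothesis f_ge0 : forall x, 0 <= f x.

Let w_dom (t : R) : 0 <= t <= T -> dominated e (w t).
Proof.
by move=> tT; apply: (@dominated_quadratic _ _ _ e_gt0 _ C) => x; exact: w_quad.
Qed.

Let min_bound (M : R) y : 0 <= M -> 0 <= Num.min (f y) M <= M.
Proof. by move=> M0; rewrite le_min f_ge0 M0 ge_min lexx orbT. Qed.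

(** The means of the truncations of [f] stay below the supersolution, hence so does
    their monotone limit. *)
Lemma integral_le_supersolution :
  (forall x, f x <= w 0 x) ->
  (forall (t : R) (x : S), 0 <= t < T -> L (w t) x <= w' t x) ->
  forall (t : R) (x : S), 0 <= t <= T ->
  (\int[p t x]_y (f y)%:E <= (w t x)%:E)%E.
Proof.
move=> fw0 Lw t x tT.
pose g (n : nat) (y : S) := (Num.min (f y) n%:R)%:E.
have gf y : (g n y @[n --> \oo] --> (f y)%:E)%E.
  apply: cvg_EFin.
    by near=> n.
  apply: (@cvg_near_eq _ _ _ _ (fun=> f y)); last exact: cvg_cst.
  near=> n; rewrite /= min_l//; near: n; exact: nbhs_infty_ger.
have := @cvg_monotone_convergence _ _ _ (p t x) setT measurableT g.
move=> cvg_g.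
have -> : (\int[p t x]_y (f y)%:E = \int[p t x]_y (limn (g^~ y)))%E.
  by apply: eq_integral => y _; apply/esym/cvg_lim.
rewrite monotone_convergence//.
- apply: lime_le.
    apply: ereal_nondecreasing_is_cvgn => m n mn; apply: ge0_le_integral => //.
    + by move=> y _; rewrite lee_fin le_min f_ge0/=.
    + by move=> y _; rewrite lee_fin le_min !ge_min lexx/= ler_nat mn orbT.
  near=> n; rewrite -(@kernel_meanE _ _ _ _ _ _ n%:R).
    rewrite lee_fin.
    apply: (@kernel_mean_le_supersolution _ _ r e e_gt0 e_le1 r_ge0 r_weight p G
      p_semigroup p_generator G_L T w w' w_deriv w_dom C n%:R) => //.
    + by move=> y; exact: min_bound.
    + by move=> s y sT; have := w_quad y sT; rewrite ler_norml => /andP[].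
    + by move=> y; rewrite ge_min fw0.
  by move=> y; have /andP[? ?] := @min_bound n%:R y (ler0n _ _); rewrite ger0_norm.
- by move=> n y _; rewrite lee_fin le_min f_ge0/=.
- by move=> y _ m n mn; rewrite lee_fin le_min !ge_min lexx/= ler_nat mn orbT.
Unshelve. all: by end_near. Qed.

(** Mass escaping to infinity would break this inequality, so truncation alone is
    not enough. Since the weight dominates quadratic functions, [f] is below its
    truncation at a high level plus an arbitrarily small multiple of the weight; that
    multiple, growing exponentially in time, is subtracted from the subsolution and
    then sent to 0. *)
Lemma integral_ge_subsolution :
  (forall x, f x <= C * (population x).+1%:R ^+ 2) ->
  (forall x, w 0 x <= f x) ->
  (forall (t : R) (x : S), 0 <= t < T -> w' t x <= L (w t) x) ->
  forall (t : R) (x : S), 0 <= t <= T ->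
  ((w t x)%:E <= \int[p t x]_y (f y)%:E)%E.
Proof.
move=> fC wf0 Lw t x tT; apply/lee_addgt0Pr => d d0.
pose W (y : S) := weight e (population y).
have W1 y : 1 <= W y by exact: weight_ge1.
have W0 y : 0 <= W y by exact: weight_ge0.
pose c := 7 * total_weighted_rate r e.
have rate0 := total_weighted_rate_ge0 e_gt0 r_ge0 r_weight.
have c0 : 0 <= c by rewrite mulr_ge0.
have LW y : L W y <= c * W y.
  exact: (branching_generator_weight e_gt0 e_le1 r_ge0 r_weight).
clearbody c.
have K0 : 0 < expR (c * t) * W x by rewrite mulr_gt0 ?expR_gt0// (lt_le_trans _ (W1 x)).
(* The total correction at time t and state x is to be exactly d. *)
have [a a0 aE] : exists2 a, 0 < a & a * (expR (c * t) * W x) = d.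
  by exists (d / (expR (c * t) * W x)); rewrite ?divr_gt0// divfK// gt_eqF.
pose v s y := 1 * w s y + (- a * expR (c * s)) * W y.
pose v' s y := 1 * w' s y + (- a * (c * expR (c * s))) * W y.
have [n0 n0P] := weight_dominates C e_gt0 a0.
(* Below n0 particles the truncation at M is inactive; above, the weight takes over. *)
pose M := `|C| * n0.+1%:R ^+ 2.
have M0 : 0 <= M by rewrite mulr_ge0// exprn_ge0.
have fmM y : `|Num.min (f y) M| <= M.
  by have /andP[? ?] := min_bound y M0; rewrite ger0_norm.
have LT (s : R) : 0 <= s < T -> 0 <= s <= T by move=> /andP[-> /ltW].
have km : v t x <= kernel_mean p t (fun y => Num.min (f y) M) x.
  apply: (@kernel_mean_ge_subsolution _ _ r e e_gt0 e_le1 r_ge0 r_weight p G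
      p_semigroup p_generator G_L T v v' _ _ C M) => //.
  - move=> s y; rewrite /v /v'.
    have ws := w_deriv s y.
    by apply: is_derive_eq; rewrite /GRing.scale/=; ring.
  - move=> s sT; apply: dominated_lin; first exact: w_dom.
    exact: dominated_weight.
  - by move=> y; exact: min_bound.
  - move=> s y sT; have := w_quad y sT; rewrite ler_norml => /andP[_].
    apply: le_trans; rewrite /v mul1r gerDl mulNr mulNr oppr_le0.
    by rewrite !mulr_ge0 ?expR_ge0 ?(ltW a0).
  - move=> y; rewrite /v mul1r mulr0 expR0 mulr1 le_min; apply/andP; split.
      rewrite (le_trans _ (wf0 y))// gerDl mulNr oppr_le0 mulr_ge0 ?(ltW a0)//.
    have [n0y|yn0] := leqP n0 (population y).
      have := n0P _ n0y; rewrite -/(W y); have := le_trans (wf0 y) (fC y).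
      move: M0; lra.
    rewrite (@le_trans _ _ (w 0 y))//.
      rewrite gerDl mulNr oppr_le0 mulr_ge0 ?(ltW a0)//.
    rewrite (le_trans (wf0 y))// (le_trans (fC y))//.
    rewrite (le_trans (ler_wpM2r _ (ler_norm C)))// ?exprn_ge0// /M.
    by rewrite ler_wpM2l// lerXn2r ?nnegrE// ler_nat ltnS ltnW.
  - move=> s y sT; rewrite /v /v' (branching_generator_lin e_gt0)//; last 2 first.
    + exact/w_dom/LT.
    + exact: dominated_weight.
    rewrite !mul1r lerD ?Lw// !mulNr lerN2 -!mulrA ler_wpM2l ?(ltW a0)//.
    by rewrite [leRHS]mulrCA ler_wpM2l ?expR_ge0.
have -> : (w t x)%:E = ((v t x)%:E + d%:E)%E.
  rewrite -EFinD; congr EFin; rewrite /v mul1r -addrA mulNr mulNr -mulrA aE.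
  by rewrite addNr addr0.
rewrite leeD2r//; apply: (@le_trans _ _ (kernel_mean p t (fun y => Num.min (f y) M) x)%:E).
  by rewrite lee_fin.
rewrite (kernel_meanE _ _ _ fmM); apply: ge0_le_integral => //.
- by move=> y _; rewrite lee_fin; case/andP: (min_bound y M0).
- by move=> y _; rewrite lee_fin ge_min lexx.
Qed.

End moment_sandwich.

(** * Linear differential equations with nonnegative off-diagonal entries *)

Lemma is_derive_expR_scale {R : realType} (a t : R) :
  is_derive t 1 (fun s => expR (a * s)) (a * expR (a * t)).
Proof.
apply: is_derive_eq; rewrite /GRing.scale/= ?mulr1 ?scaler0 ?addr0 ?add0r.
by rewrite mulrC.
Qed.

Lemma is_derive_mul {R : realType} (f g : R -> R) (t l l' : R) :
  is_derive t 1 f l -> is_derive t 1 g l' ->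
  is_derive t 1 (fun s => f s * g s) (f t * l' + g t * l).
Proof. by move=> fl gl; exact: is_deriveM. Qed.

Lemma is_derive_scale {R : realType} (c : R) (g : R -> R) (t l : R) :
  is_derive t 1 g l -> is_derive t 1 (fun s => c * g s) (c * l).
Proof. by move=> gl; exact: is_deriveZ. Qed.

Section linear_ode.
Context {R : realType}.

Lemma cvg_pseries_factorial (b : R^nat) (H d x : R) :
  (forall n, `|b n| <= H * d ^+ n) ->
  cvgn (pseries (fun n => b n / n`!%:R) x).
Proof.
move=> bH; rewrite /pseries.
apply: (cvg_series_dominated (v := fun n => H * exp_coeff (d * `|x|) n)).
  move=> n; rewrite /exp_coeff/= !normrM normrX normfV (ger0_norm (ler0n _ _)).
  rewrite [leRHS](_ : _ = H * d ^+ n * (n`!%:R^-1 * `|x| ^+ n)).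
    by rewrite -mulrA ler_wpM2r// mulr_ge0// exprn_ge0.
  by rewrite exprMn; ring.
apply: cvg_series_scale; exact: is_cvg_series_exp_coeff.
Qed.

Lemma pseries_diffs_factorial (b : R^nat) :
  pseries_diffs (fun n => b n / n`!%:R) = (fun n => b n.+1 / n`!%:R).
Proof.
by apply/funext => n; rewrite /pseries_diffs factS natrM invfM mulrCA mulVKf ?pnatr_eq0.
Qed.

(** The solution is exp(t A) v0. Adding q I, with q the sum of the absolute values
    of the diagonal, makes A entrywise nonnegative: exp(t A) is exp(- q t) times a
    power series with nonnegative terms, and the inequality A h <= c h becomes
    (A + q I)^n h <= (c + q)^n h, which bounds that series term by term. *)
Lemma linear_ode_solution (N : nat) (A : 'I_N -> 'I_N -> R) (h v0 : 'I_N -> R) (c : R) :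
  0 <= c -> (forall i j, i != j -> 0 <= A i j) ->
  (forall i, 0 <= v0 i <= h i) -> (forall i, \sum_j A i j * h j <= c * h i) ->
  exists m : R -> 'I_N -> R, [/\ forall i, m 0 i = v0 i,
    forall (t : R) i, is_derive t 1 (m^~ i) (\sum_j A i j * m t j) &
    forall (t : R) i, 0 <= t -> 0 <= m t i <= expR (c * t) * h i].
Proof.
move=> c0 A0 v0h Ah.
have h0 i : 0 <= h i by have /andP[/le_trans] := v0h i; exact.
pose q := \sum_i `|A i i|.
have q0 : 0 <= q by exact: sumr_ge0.
pose B i j := A i j + q * (i == j)%:R.
have B0 i j : 0 <= B i j.
  rewrite /B; have [->|ij] := eqVneq i j; last by rewrite mulr0 addr0 A0.
  rewrite mulr1 -lerBlDl sub0r (le_trans (ler_norm _))// normrN.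
  by rewrite /q (bigD1 j)//= lerDl sumr_ge0.
have Bsum (u : 'I_N -> R) i : \sum_j B i j * u j = \sum_j A i j * u j + q * u i.
  rewrite /B; under eq_bigr do rewrite mulrDl.
  rewrite big_split/=; congr (_ + _); rewrite (bigD1 i)//= eqxx mulr1.
  rewrite big1 ?addr0// => j; rewrite eq_sym => /negPf ->.
  by rewrite mulr0 mul0r.
pose d := c + q.
have d0 : 0 <= d by rewrite addr_ge0.
have Bh i : \sum_j B i j * h j <= d * h i by rewrite Bsum /d mulrDl lerD2r.
(* These are the entries of (A + q I)^n v0. *)
pose a := fix a n i := if n is n'.+1 then \sum_j B i j * a n' j else v0 i.
have aP n i : 0 <= a n i <= d ^+ n * h i.
  elim: n i => [|n IH] i /=; first by rewrite expr0 mul1r.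
  rewrite sumr_ge0 /=; last by move=> j _; rewrite mulr_ge0//; case/andP: (IH j).
  rewrite exprSr -mulrA (le_trans _ (ler_wpM2l _ (Bh i))) ?exprn_ge0//.
  rewrite mulr_sumr ler_sum// => j _; rewrite mulrCA ler_wpM2l//.
  by case/andP: (IH j).
have aN k n i : `|a (n + k)%N i| <= (d ^+ k * h i) * d ^+ n.
  have /andP[a0 an] := aP (n + k)%N i.
  rewrite ger0_norm// (_ : _ * d ^+ n = d ^+ (n + k) * h i)//.
  by rewrite exprD; ring.
pose E i x := limn (pseries (fun n => a n i / n`!%:R) x).
have ca i x : cvgn (pseries (fun n => a n i / n`!%:R) x).
  apply: (@cvg_pseries_factorial _ (d ^+ 0 * h i) d) => n.
  by have := aN 0 n i; rewrite addn0.
have ca1 i x : cvgn (pseries (fun n => a n.+1 i / n`!%:R) x).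
  apply: (@cvg_pseries_factorial _ (d ^+ 1 * h i) d) => n.
  by have := aN 1 n i; rewrite addn1.
have ca2 i x : cvgn (pseries (fun n => a n.+2 i / n`!%:R) x).
  apply: (@cvg_pseries_factorial _ (d ^+ 2 * h i) d) => n.
  by have := aN 2 n i; rewrite addn2.
have Ediff i (x : R) : is_derive x 1 (E i) (\sum_j B i j * E j x).
  have xK : `|x| < `| `|x| + 1|.
    by rewrite [ltRHS]ger0_norm ?addr_ge0// ltrDl.
  have := @pseries_snd_diffs R (fun n => a n i / n`!%:R) (`|x| + 1) x.
  rewrite !pseries_diffs_factorial => /(_ (ca _ _) (ca1 _ _) (ca2 _ _) xK).
  congr is_derive.
  transitivity (limn (series (fun n => \sum_j B i j * (a n j / n`!%:R * x ^+ n)))).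
    congr (limn (series _)); apply/funext => n /=.
    by rewrite -mulrA mulr_suml; apply: eq_bigr => j _; rewrite !mulrA.
  rewrite lim_series_sum; last by move=> j; apply: cvg_series_scale; exact: ca.
  by apply: eq_bigr => j _; rewrite lim_series_scale//; exact: ca.
have E0 i : E i 0 = v0 i.
  apply/cvg_lim => //; apply: (@cvg_near_eq _ _ _ _ (fun=> v0 i)); last exact: cvg_cst.
  near=> n; have n0 : (0 < n)%N by near: n; exists 1%N.
  rewrite /pseries /series/= -(prednK n0) big_nat_recl//= expr0 fact0 divr1 mulr1.
  by rewrite big1 ?addr0// => k _; rewrite exprS mul0r mulr0.
have Ebound i (x : R) : 0 <= x -> 0 <= E i x <= expR (d * x) * h i.
  move=> x0; apply/andP; split.
    apply: lim_series_ge0; last exact: ca.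
    by move=> n; rewrite mulr_ge0 ?exprn_ge0// divr_ge0//; case/andP: (aP n i).
  rewrite mulrC /expR -lim_series_scale; last exact: is_cvg_series_exp_coeff.
  apply: lim_series_mono.
  - move=> n; rewrite /exp_coeff/=.
    rewrite [leRHS](_ : _ = d ^+ n * h i * (n`!%:R^-1 * x ^+ n)).
      rewrite -mulrA ler_wpM2r// ?mulr_ge0 ?exprn_ge0//.
      by case/andP: (aP n i).
    by rewrite exprMn; ring.
  - exact: ca.
  - by apply: cvg_series_scale; exact: is_cvg_series_exp_coeff.
exists (fun t i => expR (- q * t) * E i t); split.
- by move=> i; rewrite mulr0 expR0 mul1r.
- move=> t i; have Ei := Ediff i t.
  have := is_derive_mul (is_derive_expR_scale (- q) t) Ei.
  congr is_derive; rewrite Bsum mulrDr.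
  rewrite (_ : E i t * _ = - (expR (- q * t) * (q * E i t))); last by ring.
  by rewrite addrK mulr_sumr; apply: eq_bigr => j _; rewrite mulrCA.
- move=> t i t0; have /andP[Ei0 Eile] := Ebound i t t0.
  rewrite mulr_ge0 ?expR_ge0//=.
  rewrite (le_trans (ler_wpM2l (expR_ge0 _) Eile))// mulrA -expRD.
  by rewrite -mulrDl /d addrCA addNr addr0.
Unshelve. all: by end_near. Qed.

End linear_ode.

(** * The generator on linear and bilinear functions *)

Section moments.
Context {R : realType} {N : nat} (r : nat -> 'I_N -> 'I_N -> R) (e : R).
Hypothesis e_gt0 : 0 < e.
Hypothesis r_ge0 : forall k i j, 0 <= r k i j.
Hypothesis r_weight : forall i j, cvgn (series (fun k => r k i j * weight e k)).
Local Notation S := (urn_state N).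
Local Notation L := (branching_generator r).
Implicit Types (x : S) (m u : 'I_N -> R).

(** The generator of linear and bilinear functions only involves the orders 0, 1
    and 2, for which the series converge. *)
Definition rate_moment (n : nat) i j : R :=
  limn (series (fun k => r k i j * k%:R ^+ n)).

Lemma cvg_rate_moment n i j : (n <= 2)%N ->
  cvgn (series (fun k => r k i j * k%:R ^+ n)).
Proof.
move=> n2; apply: (cvg_series_dominated _ (@r_weight i j)) => k.
rewrite ger0_norm ?mulr_ge0 ?exprn_ge0// ler_wpM2l//.
rewrite (le_trans _ (weight_ge_sqr e_gt0 k))//.
rewrite (@le_trans _ _ (k.+1%:R ^+ n))//.
  by rewrite lerXn2r ?nnegrE// ler_nat.
by rewrite ler_weXn2l// ler1n.
Qed.

Lemma lim_rate_quadratic i j (a b c : R) :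
  limn (series (fun k => r k i j * (a * k%:R ^+ 2 + b * k%:R + c))) =
  a * rate_moment 2 i j + b * rate_moment 1 i j + c * rate_moment 0 i j.
Proof.
rewrite (_ : (fun k => _) = (fun k => (a * (r k i j * k%:R ^+ 2) +
   b * (r k i j * k%:R ^+ 1)) + c * (r k i j * k%:R ^+ 0))); last first.
  by apply/funext => k; rewrite expr1 expr0; ring.
have cn n d : (n <= 2)%N -> cvgn (series (fun k => d * (r k i j * k%:R ^+ n))).
  by move=> n2; apply: cvg_series_scale; exact: cvg_rate_moment.
rewrite (lim_series_add (cvg_series_add (cn 2 a isT) (cn 1 b isT)) (cn 0 c isT)).
rewrite (lim_series_add (cn 2 a isT) (cn 1 b isT)).
rewrite (lim_series_scale a (@cvg_rate_moment 2 i j isT)).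
rewrite (lim_series_scale b (@cvg_rate_moment 1 i j isT)).
by rewrite (lim_series_scale c (@cvg_rate_moment 0 i j isT)).
Qed.

Lemma rate_moment_ge0 n i j : (n <= 2)%N -> 0 <= rate_moment n i j.
Proof.
move=> n2; apply: lim_series_ge0; last exact: cvg_rate_moment.
by move=> k; rewrite mulr_ge0 ?exprn_ge0.
Qed.

Definition dot x m : R := \sum_l (x l)%:R * m l.

Lemma dot_branch k i j x m : (0 < x i)%N ->
  dot (branch k i j x) m = dot x m + (m j * k%:R - m i).
Proof.
move=> xi; rewrite /dot.
have mi : m i = \sum_l (l == i)%:R * m l.
  by rewrite (bigD1 i)//= eqxx mul1r big1 ?addr0// => l /negPf ->; rewrite mul0r.
have mj : m j * k%:R = \sum_l (k * (l == j))%:R * m l.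
  rewrite (bigD1 j)//= eqxx muln1 mulrC big1 ?addr0// => l /negPf ->.
  by rewrite muln0 mul0r.
rewrite mi mj -sumrB -big_split/=; apply: eq_bigr => l _.
rewrite /branch ffunE natrD natrB; first by ring.
by case: eqP => [->|].
Qed.

Lemma dot_quadratic m x : `|dot x m| <= (\sum_l `|m l|) * (population x).+1%:R.
Proof.
rewrite (le_trans (ler_norm_sum _ _ _))// mulr_suml ler_sum// => l _.
rewrite normrM mulrC ler_wpM2l// ger0_norm// ler_nat /population (bigD1 l)//=.
by rewrite -addnS leq_addr.
Qed.

(** The generator maps the linear function of vector [m] to that of vector
    [drift m], so means solve a linear differential equation in dimension N. *)
Definition drift m i := \sum_j (rate_moment 1 i j * m j - rate_moment 0 i j * m i).

Lemma branching_generator_dot m x : L (dot^~ m) x = dot x (drift m).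
Proof.
rewrite /branching_generator /dot; apply: eq_bigr => i _.
rewrite /drift mulr_sumr; apply: eq_bigr => j _.
have [->|xi] := posnP (x i); first by rewrite !mul0r.
congr (_ * _).
rewrite (_ : (fun k => _) = (fun k => r k i j * (0 * k%:R ^+ 2 + m j * k%:R + - m i))).
  by rewrite lim_rate_quadratic; ring.
by apply/funext => k; rewrite -/(dot _ m) -/(dot _ m) dot_branch//; ring.
Qed.

(** The failure of the Leibniz rule for the generator: the rate at which a particle
    of urn [i] produces joint jumps of the linear functions of vectors [m] and [u],
    with the product (m_j k - m_i) (u_j k - u_i) expanded in powers of k. *)
Definition jump_covariance m u i := \sum_j
  (m j * u j * rate_moment 2 i j - (m j * u i + m i * u j) * rate_moment 1 i j
   + m i * u i * rate_moment 0 i j).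

Lemma branching_generator_dot_mul m u x : L (fun y => dot y m * dot y u) x =
  dot x m * dot x (drift u) + dot x (drift m) * dot x u + dot x (jump_covariance m u).
Proof.
have dot_sum F : dot x (fun i => \sum_j F i j) = \sum_i \sum_j (x i)%:R * F i j.
  by rewrite /dot; apply: eq_bigr => i _; rewrite mulr_sumr.
have dr u' : dot x (drift u') = \sum_i \sum_j (x i)%:R *
    (rate_moment 1 i j * u' j - rate_moment 0 i j * u' i) by exact: dot_sum.
have dj : dot x (jump_covariance m u) = \sum_i \sum_j (x i)%:R *
  (m j * u j * rate_moment 2 i j - (m j * u i + m i * u j) * rate_moment 1 i j
   + m i * u i * rate_moment 0 i j) by exact: dot_sum.
rewrite /branching_generator !dr dj.
rewrite [X in X + _ + _]mulr_sumr [X in _ + X + _]mulr_suml -!big_split/=.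
apply: eq_bigr => i _.
rewrite [X in X + _ + _]mulr_sumr [X in _ + X + _]mulr_suml -!big_split/=.
apply: eq_bigr => j _.
have [->|xi] := posnP (x i); first by rewrite !(mul0r, mulr0, addr0).
rewrite (_ : (fun k => _) = (fun k => r k i j * (m j * u j * k%:R ^+ 2 +
   (dot x m * u j + m j * dot x u - m j * u i - m i * u j) * k%:R +
   (- dot x m * u i - m i * dot x u + m i * u i)))).
  by rewrite lim_rate_quadratic; ring.
by apply/funext => k; rewrite !dot_branch//; ring.
Qed.

Lemma jump_covariance_norm m u i : (forall j, 0 <= m j) -> (forall j, 0 <= u j) ->
  `|jump_covariance m u i| <=
  \sum_j limn (series (fun k => r k i j * k.+1%:R ^+ 2)) *
         ((m j + m i) * (u j + u i)).
Proof.
move=> m0 u0; rewrite (le_trans (ler_norm_sum _ _ _))// ler_sum// => j _.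
have -> : limn (series (fun k => r k i j * k.+1%:R ^+ 2)) =
    rate_moment 2 i j + 2 * rate_moment 1 i j + rate_moment 0 i j.
  rewrite (_ : (fun k => _) = (fun k => r k i j * (1 * k%:R ^+ 2 + 2 * k%:R + 1))).
    by rewrite lim_rate_quadratic !mul1r.
  by apply/funext => k; rewrite -addn1 natrD; ring.
have R2 := @rate_moment_ge0 2 i j isT; have R1 := @rate_moment_ge0 1 i j isT.
have R0 := @rate_moment_ge0 0 i j isT.
move: (rate_moment 2 i j) (rate_moment 1 i j) (rate_moment 0 i j) R2 R1 R0.
move=> a b c a0 b0 c0.
have mm := mulr_ge0 (m0 j) (u0 j). have mi := mulr_ge0 (m0 j) (u0 i).
have im := mulr_ge0 (m0 i) (u0 j). have ii := mulr_ge0 (m0 i) (u0 i).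
rewrite (mulrDl (m j)) !mulrDr.
move: (m j * u j) (m j * u i) (m i * u j) (m i * u i) mm mi im ii.
move=> p q s t p0 q0 s0 t0.
have := mulr_ge0 a0 p0; have := mulr_ge0 a0 q0;
have := mulr_ge0 a0 s0; have := mulr_ge0 a0 t0;
have := mulr_ge0 b0 p0; have := mulr_ge0 b0 q0;
have := mulr_ge0 b0 s0; have := mulr_ge0 b0 t0;
have := mulr_ge0 c0 p0; have := mulr_ge0 c0 q0;
have := mulr_ge0 c0 s0; have := mulr_ge0 c0 t0;
rewrite ler_norml => *; apply/andP; split; lra.
Qed.

End moments.

(** * First and second moments from a deterministic initial state *)

Section moment_bounds.
Context {R : realType} {N : nat} (r : nat -> 'I_N -> 'I_N -> R) (e : R).
Hypotheses (e_gt0 : 0 < e) (e_le1 : e <= 1).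
Hypothesis r_ge0 : forall k i j, 0 <= r k i j.
Hypothesis r_weight : forall i j, cvgn (series (fun k => r k i j * weight e k)).
Local Notation S := (urn_state N).
Local Notation L := (branching_generator r).
Implicit Types (x : S) (u : 'I_N -> R).
Variable K : R.
Hypotheses (N_gt0 : (0 < N)%N) (K_ge0 : 0 <= K).
Hypothesis r_mean_field : forall i j,
  limn (series (fun k => r k i j * k.+1%:R ^+ 2)) <= K * ((i == j)%:R + N%:R^-1).

Let Nv_ge0 : 0 <= N%:R^-1 :> R. Proof. by rewrite invr_ge0. Qed.

(** The mean-field order of magnitude of a quantity attached to urn [a], seen from
    urn [l]: of order 1 on [a] itself and 1/N elsewhere. Everything rests on the
    stability of this shape under the mean flow and on the sum over l of the product
    of the profiles of two distinct urns being of order 1/N. *)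
Definition profile (a l : 'I_N) : R := (l == a)%:R + N%:R^-1.

Lemma profile_ge0 a l : 0 <= profile a l.
Proof. by rewrite addr_ge0. Qed.

Lemma sum_delta (a : 'I_N) u : \sum_l (l == a)%:R * u l = u a.
Proof.
rewrite (bigD1 a)//= eqxx mul1r big1 ?addr0// => l /negPf ->.
by rewrite mul0r.
Qed.

Lemma sum_mean_field (K' : R) l u :
  \sum_j K' * ((l == j)%:R + N%:R^-1) * u j = K' * (u l + N%:R^-1 * \sum_j u j).
Proof.
transitivity (\sum_j (K' * ((j == l)%:R * u j) + K' * (N%:R^-1 * u j))).
  by apply: eq_bigr => j _; rewrite eq_sym; ring.
by rewrite big_split/= -!mulr_sumr sum_delta mulrDr.
Qed.

Lemma sum_profile a : \sum_l profile a l = 2.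
Proof.
rewrite big_split/= sumr_const card_ord -[_ *+ N]mulr_natr mulVf ?pnatr_eq0 ?gtn_eqF//.
rewrite -[X in X + _](_ : \sum_l (l == a)%:R * 1 = _); last first.
  by apply: eq_bigr => l _; rewrite mulr1.
by rewrite sum_delta.
Qed.

Lemma sum_profile_mul a b : a != b -> \sum_l profile a l * profile b l = 3 / N%:R.
Proof.
move=> ab.
have N0 : N%:R != 0 :> R by rewrite pnatr_eq0 gtn_eqF.
have -> : \sum_l profile a l * profile b l =
  \sum_l (l == a)%:R * profile b l + N%:R^-1 * \sum_l profile b l.
  by rewrite mulr_sumr -big_split/=; apply: eq_bigr => l _; rewrite -mulrDl.
rewrite sum_delta sum_profile /profile (negPf ab) add0r; field.
exact: N0.
Qed.

Lemma rate_moment1_le i j : rate_moment r 1 i j <= K * ((i == j)%:R + N%:R^-1).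
Proof.
apply: le_trans (r_mean_field i j); apply: lim_series_mono.
- move=> k; rewrite ler_wpM2l// expr1 (@le_trans _ _ k.+1%:R)// ?ler_nat//.
  by rewrite expr2 ler_peMr// ler1n.
- exact: (cvg_rate_moment e_gt0 r_ge0 r_weight).
- apply: (cvg_series_dominated _ (@r_weight i j)) => k.
  by rewrite ger0_norm ?mulr_ge0 ?exprn_ge0// ler_wpM2l// weight_ge_sqr.
Qed.

Lemma drift_le u l : (forall j, 0 <= u j) ->
  drift r u l <= K * (u l + N%:R^-1 * \sum_j u j).
Proof.
move=> u0; rewrite -sum_mean_field /drift ler_sum// => j _.
rewrite lerBlDr -[leLHS]addr0 lerD//.
  by rewrite ler_wpM2r// rate_moment1_le.
by rewrite mulr_ge0// (rate_moment_ge0 e_gt0 r_ge0 r_weight).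
Qed.

Lemma drift_profile_le a l : drift r (profile a) l <= (3 * K) * profile a l.
Proof.
rewrite (le_trans (drift_le _ (profile_ge0 a)))// sum_profile (mulrC 3) -mulrA.
rewrite ler_wpM2l// /profile; case: (l == a) => /=; move: Nv_ge0; lra.
Qed.

Lemma drift_profile_mul_le a b l : a != b ->
  drift r (fun l => profile a l * profile b l) l <=
  (4 * K) * (profile a l * profile b l).
Proof.
move=> ab; rewrite (le_trans (drift_le _ _))//.
  by move=> j; rewrite mulr_ge0 ?profile_ge0.
rewrite sum_profile_mul// (mulrC 4) -mulrA ler_wpM2l//.
have h : N%:R^-1 * N%:R^-1 <= profile a l * profile b l.
  by rewrite ler_pM// /profile lerDr.
by move: h; rewrite (mulrC 3) (mulrA _ _ 3); lra.
Qed.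

(** Expanding the products of profiles, every term is either a multiple of the
    product of the profiles of [a] and [b] at [l], or 1/N times one of these profiles
    or times their mixed sum. A profile is at least 1/N, and the mixed sum is only
    3/N because [a] and [b] are distinct, so all terms are at most multiples of that
    product. *)
Lemma jump_covariance_profile_le a b (E : R) (m m' : 'I_N -> R) l : a != b ->
  0 <= E -> (forall j, 0 <= m j <= E * profile a j) ->
  (forall j, 0 <= m' j <= E * profile b j) ->
  `|jump_covariance r m m' l| <= (12 * K * E ^+ 2) * (profile a l * profile b l).
Proof.
move=> ab E0 mE m'E.
have m0 j : 0 <= m j by case/andP: (mE j).
have m'0 j : 0 <= m' j by case/andP: (m'E j).
rewrite (le_trans (jump_covariance_norm e_gt0 r_ge0 r_weight _ m0 m'0))//.
pose g j := E ^+ 2 * ((profile a j + profile a l) * (profile b j + profile b l)).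
apply: (@le_trans _ _ (\sum_j K * ((l == j)%:R + N%:R^-1) * g j)).
  rewrite ler_sum// => j _; rewrite ler_pM ?mulr_ge0 ?addr_ge0//.
    apply: lim_series_ge0 => [k|]; first by rewrite mulr_ge0// exprn_ge0.
    apply: (cvg_series_dominated _ (@r_weight l j)) => k.
    by rewrite ger0_norm ?mulr_ge0 ?exprn_ge0// ler_wpM2l// weight_ge_sqr.
  rewrite /g expr2 mulrACA ler_pM ?addr_ge0// mulrDr lerD//.
  - by case/andP: (mE j).
  - by case/andP: (mE l).
  - by case/andP: (m'E j).
  - by case/andP: (m'E l).
rewrite sum_mean_field {1}/g -mulr_sumr.
have -> : \sum_j (profile a j + profile a l) * (profile b j + profile b l) =
    3 / N%:R + 2 * profile a l + 2 * profile b l + N%:R * (profile a l * profile b l).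
  under eq_bigr => j _ do
    rewrite (mulrDl (profile a j)) !(mulrDr _ (profile b j)).
  rewrite !big_split/= sum_profile_mul// -mulr_suml -mulr_sumr !sum_profile.
  by rewrite sumr_const card_ord -[_ *+ N]mulr_natr; ring.
have N0 : N%:R != 0 :> R by rewrite pnatr_eq0 gtn_eqF.
rewrite [leLHS](_ : _ = K * E ^+ 2 * (4 * (profile a l * profile b l) +
   N%:R^-1 * (3 / N%:R + 2 * profile a l + 2 * profile b l) + profile a l * profile b l)).
  rewrite (_ : 12 * K * _ * _ = K * E ^+ 2 * (12 * (profile a l * profile b l))); last by ring.
  rewrite ler_wpM2l ?mulr_ge0 ?exprn_ge0//.
  rewrite /profile; set n := N%:R^-1.
  have n0 : 0 <= n by [].
  have nn : 0 <= n * n by rewrite mulr_ge0.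
  case: (eqVneq l a) => [->|la]; last case: (eqVneq l b) => [lb|lb] /=.
  - rewrite (negPf ab) /=; nra.
  - nra.
  - nra.
by field.
Qed.

(** The vector m t solves the backward equation with initial value the indicator of
    [a]: its l-th entry is the mean number of particles in urn [a] at time t produced
    by one particle starting in urn [l]. *)
Lemma mean_flow a : exists m : R -> 'I_N -> R, [/\ forall i, m 0 i = (i == a)%:R,
  forall (t : R) i, is_derive t 1 (m^~ i) (drift r (m t) i) &
  forall (t : R) i, 0 <= t -> 0 <= m t i <= expR (3 * K * t) * profile a i].
Proof.
pose A i j := rate_moment r 1 i j - (j == i)%:R * \sum_l rate_moment r 0 i l.
have AE u i : \sum_j A i j * u j = drift r u i.
  rewrite /A /drift sumrB -mulr_suml; under eq_bigr do rewrite mulrBl.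
  rewrite sumrB; congr (_ - _).
  under eq_bigr do rewrite -mulrA.
  by rewrite sum_delta.
have A0 i j : i != j -> 0 <= A i j.
  move=> /negPf ij; rewrite /A eq_sym ij mul0r subr0.
  exact: (rate_moment_ge0 e_gt0 r_ge0 r_weight).
have init i : (0 : R) <= (i == a)%:R <= profile a i by rewrite ler0n lerDl.
have Ah i : \sum_j A i j * profile a j <= 3 * K * profile a i.
  by rewrite AE drift_profile_le.
have [m [m0 dm mle]] := linear_ode_solution (mulr_ge0 (ler0n _ 3) K_ge0) A0 init Ah.
by exists m; split=> // t i; rewrite -AE; exact: dm.
Qed.

Context (p : R -> R.-pker S ~> S) (G : (S -> R) -> S -> R).
Hypotheses (p_semigroup : transition_semigroup p)
  (p_generator : has_generator p G).
Hypothesis G_L : forall (f : S -> R) x, dominated e f -> G f x = L f x.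

Lemma is_derive_dot x (m : R -> 'I_N -> R) (dm : 'I_N -> R) (t : R) :
  (forall i, is_derive t 1 (m^~ i) (dm i)) ->
  is_derive t 1 (fun s => dot x (m s)) (dot x dm).
Proof.
move=> mD.
have := @is_derive_sum _ _ _ N (fun l s => (x l)%:R * m s l) t 1
  (fun l => (x l)%:R * dm l).
rewrite (_ : \sum_(i < N) _ = (fun s => dot x (m s))).
  by apply=> l; exact: is_derive_scale (mD l).
by apply/funext => s; rewrite /dot fct_sumE.
Qed.

Section flow.
Context (a : 'I_N) (m : R -> 'I_N -> R).
Hypothesis m_init : forall i, m 0 i = (i == a)%:R.
Hypothesis m_deriv : forall (t : R) i, is_derive t 1 (m^~ i) (drift r (m t) i).
Hypothesis m_bound : forall (t : R) i, 0 <= t ->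
  0 <= m t i <= expR (3 * K * t) * profile a i.

Lemma dot_flow_bound (T t : R) x : 0 <= t <= T ->
  `|dot x (m t)| <= (2 * expR (3 * K * T)) * (population x).+1%:R.
Proof.
move=> /andP[t0 tT]; rewrite (le_trans (dot_quadratic _ _))// ler_wpM2r//.
rewrite (@le_trans _ _ (\sum_l expR (3 * K * T) * profile a l))//; last first.
  by rewrite -mulr_sumr sum_profile mulrC.
rewrite ler_sum// => l _; have /andP[m0 mle] := m_bound l t0.
rewrite ger0_norm// (le_trans mle)// ler_wpM2r ?profile_ge0// ler_expR.
by rewrite ler_wpM2l// mulr_ge0.
Qed.

Lemma dot_flow0 x : dot x (m 0) = (x a)%:R.
Proof.
rewrite /dot -[RHS](sum_delta a (fun l => (x l)%:R)); apply: eq_bigr => l _.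
by rewrite m_init mulrC.
Qed.

End flow.

Lemma coord_le_population x a : (x a)%:R <= (population x).+1%:R :> R.
Proof. by rewrite ler_nat /population (bigD1 a)//= -addnS leq_addr. Qed.

(** The linear function of vector [m t] solves the backward equation exactly, so it
    is both a subsolution and a supersolution. *)
Lemma mean_identity a (m : R -> 'I_N -> R) (t : R) x :
  (forall i, m 0 i = (i == a)%:R) ->
  (forall (t : R) i, is_derive t 1 (m^~ i) (drift r (m t) i)) ->
  (forall (t : R) i, 0 <= t -> 0 <= m t i <= expR (3 * K * t) * profile a i) ->
  0 <= t -> (\int[p t x]_y ((y a)%:R : R)%:E = (dot x (m t))%:E)%E.
Proof.
move=> m0 md mb t0.
pose w s y := dot y (m s); pose w' s y := dot y (drift r (m s)).
pose C := 2 * expR (3 * K * t).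
have wd (s : R) y : is_derive s 1 (w^~ y) (w' s y).
  by apply: is_derive_dot => i; exact: md.
have C1 : 1 <= C.
  rewrite /C; have : 1 <= expR (3 * K * t) by rewrite -expR0 ler_expR !mulr_ge0.
  lra.
have pop_sqr (y : S) : (population y).+1%:R <= (population y).+1%:R ^+ 2 :> R.
  by rewrite expr2 ler_peMr// ler1n.
have wq (s : R) y : 0 <= s <= t -> `|w s y| <= C * (population y).+1%:R ^+ 2.
  by move=> st; rewrite (le_trans (dot_flow_bound mb _ st))// ler_wpM2l.
have f0 (y : S) : 0 <= (y a)%:R :> R by [].
have Lw (s : R) y : L (w s) y = w' s y.
  exact: (branching_generator_dot e_gt0 r_ge0 r_weight).
have tt : 0 <= t <= t by rewrite t0 lexx.
apply/eqP; rewrite eq_le; apply/andP; split.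
- apply: (@integral_le_supersolution _ _ r e e_gt0 e_le1 r_ge0 r_weight p G
    p_semigroup p_generator G_L t C _ w w' wd wq f0) => //.
  + by move=> y; rewrite /w (dot_flow0 m0).
  + by move=> s y _; rewrite Lw.
- apply: (@integral_ge_subsolution _ _ r e e_gt0 e_le1 r_ge0 r_weight p G
    p_semigroup p_generator G_L t C _ w w' wd wq f0) => //.
  + move=> y; rewrite (le_trans (coord_le_population y a))//.
    by rewrite (le_trans (pop_sqr y))// ler_peMl// exprn_ge0.
  + by move=> y; rewrite /w (dot_flow0 m0).
  + by move=> s y _; rewrite Lw.
Qed.

(** The factor 12 * K * expR (3 * K * T) ^+ 2 bounds [jump_covariance] along the two
    mean flows up to time T, and 4 * K is the growth rate of products of profiles;
    the additional 1 lets the exponential absorb the source term. *)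
Definition error_rate (T : R) : R :=
  12 * K * expR (3 * K * T) ^+ 2 * expR ((4 * K + 1) * T).

Definition error_term (T : R) (a b : 'I_N) x : R :=
  error_rate T * dot x (fun l => profile a l * profile b l).

Lemma error_rate_ge0 (T : R) : 0 <= error_rate T.
Proof.
by rewrite /error_rate mulr_ge0 ?expR_ge0// mulr_ge0 ?exprn_ge0 ?expR_ge0// mulr_ge0.
Qed.

Lemma error_rate_le (s T : R) : s <= T -> error_rate s <= error_rate T.
Proof.
move=> sT; rewrite /error_rate ler_pM ?expR_ge0//.
- by rewrite mulr_ge0 ?exprn_ge0 ?expR_ge0// mulr_ge0.
- rewrite ler_wpM2l ?mulr_ge0// lerXn2r ?nnegrE ?expR_ge0//.
  by rewrite ler_expR ler_wpM2l// mulr_ge0.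
- by rewrite ler_expR ler_wpM2l// addr_ge0// mulr_ge0.
Qed.

(** The product of the two means solves the backward equation up to the term
    [jump_covariance]. Adding or subtracting the linear function of vector
    [profile a * profile b], multiplied by a growing exponential, absorbs this term
    and yields a supersolution and a subsolution. *)
Lemma second_moment_bounds a b (m m' : R -> 'I_N -> R) (T : R) x : a != b ->
  (forall i, m 0 i = (i == a)%:R) -> (forall i, m' 0 i = (i == b)%:R) ->
  (forall (t : R) i, is_derive t 1 (m^~ i) (drift r (m t) i)) ->
  (forall (t : R) i, is_derive t 1 (m'^~ i) (drift r (m' t) i)) ->
  (forall (t : R) i, 0 <= t -> 0 <= m t i <= expR (3 * K * t) * profile a i) ->
  (forall (t : R) i, 0 <= t -> 0 <= m' t i <= expR (3 * K * t) * profile b i) ->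
  0 <= T ->
  ((dot x (m T) * dot x (m' T) - error_term T a b x)%:E <=
     \int[p T x]_y ((y a)%:R * (y b)%:R : R)%:E <=
   (dot x (m T) * dot x (m' T) + error_term T a b x)%:E)%E.
Proof.
move=> ab m0 m'0 md m'd mb m'b T0.
pose E := expR (3 * K * T); pose D0 := 12 * K * E ^+ 2.
have E1 : 1 <= E by rewrite -expR0 ler_expR !mulr_ge0.
have D00 : 0 <= D0 by rewrite !mulr_ge0 ?expR_ge0.
pose H l := profile a l * profile b l.
have H0 l : 0 <= H l by rewrite mulr_ge0 ?profile_ge0.
pose c := 4 * K + 1.
have c0 : 0 <= c by rewrite addr_ge0// mulr_ge0.
pose q s y := dot y (m s) * dot y (m' s).
pose z s y := D0 * expR (c * s) * dot y H.
pose w sg s y := 1 * q s y + sg * z s y.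
pose w' sg s y := (dot y (m s) * dot y (drift r (m' s)) +
  dot y (m' s) * dot y (drift r (m s))) + sg * (c * z s y).
have qd (s : R) y : is_derive s 1 (q^~ y) (dot y (m s) * dot y (drift r (m' s)) +
    dot y (m' s) * dot y (drift r (m s))).
  exact: (is_derive_mul (is_derive_dot y (md s)) (is_derive_dot y (m'd s))).
have zd (s : R) y : is_derive s 1 (z^~ y) (c * z s y).
  have := is_derive_scale (D0 * dot y H) (is_derive_expR_scale c s).
  rewrite /z; congr is_derive; last by ring.
  by apply/funext => u; rewrite mulrAC.
have wd sg (s : R) y : is_derive s 1 ((w sg)^~ y) (w' sg s y).
  rewrite /w /w'; have sz := is_derive_scale sg (zd s y).
  have := is_deriveD (qd s y) sz.
  by congr is_derive; apply/funext => u; rewrite mul1r.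
have LT (s : R) : 0 <= s <= T -> expR (3 * K * s) <= E.
  by move=> /andP[_ sT]; rewrite ler_expR ler_wpM2l// mulr_ge0.
pose Cz := D0 * expR (c * T) * \sum_l `|H l|.
have Cz0 : 0 <= Cz by rewrite mulr_ge0 ?sumr_ge0// mulr_ge0 ?expR_ge0.
pose C := (2 * E) * (2 * E) + Cz.
have C1 : 1 <= C by rewrite /C; nra.
have pop_sqr (y : S) : (population y).+1%:R <= (population y).+1%:R ^+ 2 :> R.
  by rewrite expr2 ler_peMr// ler1n.
have qq (s : R) y : 0 <= s <= T ->
    `|q s y| <= (2 * E) * (2 * E) * (population y).+1%:R ^+ 2.
  move=> sT; rewrite normrM expr2 mulrACA ler_pM//.
    exact: (dot_flow_bound mb _ sT).
  exact: (dot_flow_bound m'b _ sT).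
have zz (s : R) y : 0 <= s <= T -> `|z s y| <= Cz * (population y).+1%:R ^+ 2.
  move=> /andP[s0 sT]; rewrite normrM ger0_norm; last by rewrite mulr_ge0 ?expR_ge0.
  rewrite -[leRHS]mulrA ler_pM ?mulr_ge0 ?expR_ge0//.
    by rewrite ler_wpM2l// ler_expR ler_wpM2l.
  by rewrite (le_trans (dot_quadratic _ _))// ler_wpM2l// sumr_ge0.
have wq sg (s : R) y : `|sg| = 1 -> 0 <= s <= T ->
    `|w sg s y| <= C * (population y).+1%:R ^+ 2.
  move=> sg1 sT; rewrite /w mul1r (le_trans (ler_normD _ _))// (normrM sg) sg1 mul1r mulrDl.
  by rewrite lerD ?qq ?zz.
have f0 (y : S) : 0 <= (y a)%:R * (y b)%:R :> R by rewrite mulr_ge0.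
have TT : 0 <= T <= T by rewrite T0 lexx.
have z0 (s : R) y : 0 <= z s y.
  by rewrite !mulr_ge0 ?expR_ge0//; apply: sumr_ge0 => l _; rewrite mulr_ge0.
have Lw sg (s : R) y : 0 <= s <= T -> L (w sg s) y =
    dot y (m s) * dot y (drift r (m' s)) + dot y (drift r (m s)) * dot y (m' s) +
    dot y (jump_covariance r (m s) (m' s)) +
    sg * (D0 * expR (c * s) * dot y (drift r H)).
  move=> sT; rewrite /w (branching_generator_lin e_gt0)//; last 2 first.
  - by apply: (dominated_quadratic e_gt0 (C := (2 * E) * (2 * E))) => u; exact: qq.
  - by apply: (dominated_quadratic e_gt0 (C := Cz)) => u; exact: zz.
  rewrite mul1r (branching_generator_dot_mul e_gt0 r_ge0 r_weight).
  congr (_ + sg * _).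
  rewrite (_ : z s = fun v => D0 * expR (c * s) * dot v H + 0 * dot v H); last first.
    by apply/funext => v; rewrite mul0r addr0.
  have Hdom : dominated e (dot^~ H).
    apply: (dominated_quadratic e_gt0 (C := \sum_l `|H l|)) => u.
    by rewrite (le_trans (dot_quadratic _ _))// ler_wpM2l// sumr_ge0.
  by rewrite (branching_generator_lin e_gt0)// mul0r addr0
    (branching_generator_dot e_gt0 r_ge0 r_weight).
have key (s : R) y : 0 <= s <= T -> `|dot y (jump_covariance r (m s) (m' s))| +
    D0 * expR (c * s) * dot y (drift r H) <= c * z s y.
  move=> sT; have /andP[s0 _] := sT.
  have e1 : 1 <= expR (c * s) by rewrite -expR0 ler_expR mulr_ge0.
  apply: (@le_trans _ _ (D0 * dot y H + D0 * expR (c * s) * (4 * K * dot y H))).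
    apply: lerD.
      rewrite (le_trans (ler_norm_sum _ _ _))// /dot mulr_sumr ler_sum// => l _.
      rewrite normrM ger0_norm// mulrCA ler_wpM2l//.
      apply: jump_covariance_profile_le => //.
      - by rewrite (le_trans ler01).
      - move=> j; have /andP[-> mj] := mb s j s0.
        by rewrite (le_trans mj)// ler_wpM2r ?profile_ge0// LT.
      - move=> j; have /andP[-> mj] := m'b s j s0.
        by rewrite (le_trans mj)// ler_wpM2r ?profile_ge0// LT.
    rewrite ler_wpM2l ?mulr_ge0 ?expR_ge0// /dot mulr_sumr ler_sum// => l _.
    by rewrite mulrCA ler_wpM2l// drift_profile_mul_le.
  have dH0 : 0 <= dot y H by apply: sumr_ge0 => l _; rewrite mulr_ge0.
  have -> : c * z s y =
      D0 * expR (c * s) * dot y H + D0 * expR (c * s) * (4 * K * dot y H).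
    by rewrite /z {1}/c; ring.
  by rewrite lerD2r ler_wpM2r// ler_peMr.
have -> : error_term T a b x = z T x.
  by rewrite /error_term /error_rate /z -/E -/D0 -/c.
apply/andP; split.
- have -> : dot x (m T) * dot x (m' T) - z T x = w (-1) T x.
    by rewrite /w mul1r mulN1r.
  apply: (@integral_ge_subsolution _ _ r e e_gt0 e_le1 r_ge0 r_weight p G
    p_semigroup p_generator G_L T C _ (w (-1)) (w' (-1)) (wd (-1)) _ f0) => //.
  + by move=> s y sT; apply: wq => //; rewrite normrN1.
  + move=> y; rewrite (le_trans _ (ler_wpM2r _ C1)) ?exprn_ge0// mul1r expr2.
    by rewrite ler_pM// coord_le_population.
  + by move=> y; rewrite /w mul1r mulN1r /q (dot_flow0 m0) (dot_flow0 m'0) gerBl z0.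
  + move=> s y /andP[s0 sT].
    have sT' : 0 <= s <= T by rewrite s0 ltW.
    have := key s y sT'; rewrite Lw// /w'.
    have := ler_norm (- dot y (jump_covariance r (m s) (m' s))); rewrite normrN.
    lra.
- have -> : dot x (m T) * dot x (m' T) + z T x = w 1 T x by rewrite /w !mul1r.
  apply: (@integral_le_supersolution _ _ r e e_gt0 e_le1 r_ge0 r_weight p G
    p_semigroup p_generator G_L T C _ (w 1) (w' 1) (wd 1) _ f0) => //.
  + by move=> s y sT; apply: wq => //; rewrite normr1.
  + by move=> y; rewrite /w !mul1r /q (dot_flow0 m0) (dot_flow0 m'0) lerDl z0.
  + move=> s y /andP[s0 sT].
    have sT' : 0 <= s <= T by rewrite s0 ltW.
    have := key s y sT'; rewrite Lw// /w'.
    have := ler_norm (dot y (jump_covariance r (m s) (m' s))).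
    lra.
Qed.

End moment_bounds.

(** * Law of the process and of its initial state *)

Section nonneg_series.
Context {R : realType}.

Lemma eseries_EFin (u : R^nat) : (forall k, 0 <= u k) -> cvgn (series u) ->
  (\sum_(0 <= k <oo) (u k)%:E = (limn (series u))%:E)%E.
Proof.
move=> u0 cu; apply/cvg_lim => //.
rewrite (_ : (fun n => _) = EFin \o series u).
  by apply: cvg_EFin => //; near=> n.
by apply/funext => n /=; rewrite sumEFin.
Unshelve. all: by end_near. Qed.

(** With this expansion, the integral of a product of coordinates only involves
    probabilities of events that constrain one coordinate each. *)
Lemma nat_layer_cake (n : nat) :
  (n%:R%:E = \sum_(0 <= a <oo) ((a < n)%N%:R : R)%:E)%E.
Proof.
rewrite (nneseries_split _ n)// add0n eseries0 ?adde0.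
  rewrite sumEFin; congr EFin.
  rewrite (eq_big_nat _ _ (F2 := fun=> 1)) => [|i /andP[_ ->]//].
  by rewrite big_const_nat subn0 iter_addr_0.
by move=> i ni _; rewrite ltnNge ni.
Qed.

End nonneg_series.

Section markov_law.
Context {R : realType} {N : nat} {d : measure_display} {T : measurableType d}
  {P : probability T R}.
Local Notation S := (urn_state N).
Context (p : R -> R.-pker S ~> S) (X : R -> {RV P >-> S}).
Hypothesis X_markov : markov_process p X.
Local Open Scope ereal_scope.

Lemma measurable_urn_event (Y : {RV P >-> S}) (B : set S) : measurable (Y @^-1` B).
Proof. by rewrite -[_ @^-1` _]setTI; exact: (@measurable_funPT _ _ _ _ Y). Qed.

Lemma markov_law_set (s : R) (B : set S) : (0 <= s)%R ->
  P (X s @^-1` B) = \int[P]_w p s (X 0%R w) B.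
Proof.
move=> s0.
transitivity (\int[distribution P (X 0%R)]_y p s y B); last first.
  by rewrite ge0_integral_distribution.
rewrite ge0_integral_cell//.
have -> : X s @^-1` B = \bigcup_n (X 0%R @^-1` (cell n) `&` X s @^-1` B).
  by rewrite -setI_bigcupl -preimage_bigcup bigcup_cell preimage_setT setTI.
rewrite measure_bigcup//=.
- rewrite (eq_eseriesl (Q := xpredT)); last by move=> n; rewrite in_setT.
  apply: eq_eseriesr => n _; rewrite /cell_value /cell /distribution/= /pushforward.
  case: pickle_inv => [y|]; last by rewrite preimage_set0 set0I measure0 mule0.
  have hT : history X 0 setT.
    suff : history X 0 (setT `\` set0) by rewrite setD0.
    by apply: sigma_algebraCD; exact: sigma_algebra0.
  have mB : measurable B by [].
  have := X_markov (lexx 0%R) s0 hT y mB.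
  by rewrite !setTI add0r muleC.
- by move=> n _; apply: measurableI; exact: measurable_urn_event.
- apply/trivIsetP => m n _ _ mn; rewrite setIACA -preimage_setI.
  by have /trivIsetP/(_ m n Logic.I Logic.I mn) -> := @trivIset_cell N;
    rewrite preimage_set0 set0I.
Qed.

Lemma markov_law (s : R) (f : S -> \bar R) : (0 <= s)%R -> (forall y, 0 <= f y) ->
  \int[P]_w f (X s w) = \int[P]_w \int[p s (X 0%R w)]_y f y.
Proof.
move=> s0 f0; transitivity (\int[distribution P (X s)]_y f y).
  by rewrite ge0_integral_distribution.
apply: (integral_mixture (mu := P) (k := fun w => p s (X 0%R w))) => //.
- move=> B; apply: (measurableT_comp (f := fun x => p s x B)) => //.
- by move=> B; rewrite -markov_law_set.
Qed.

End markov_law.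

Section coordinate_moments.
Context {R : realType} {N : nat} (mu : {measure set (urn_state N) -> \bar R}).
Local Notation S := (urn_state N).
Local Open Scope ereal_scope.

Definition coord_gt (l : 'I_N) (a : nat) : set S := [set y : S | (a < y l)%N].

Lemma coord_gtE l a (y : S) : (a < y l)%N = (y \in coord_gt l a).
Proof. by apply/idP/idP; rewrite inE. Qed.

Lemma integral_indic_coord (B : set S) l :
  \int[mu]_y (\1_B y * (y l)%:R)%:E = \sum_(0 <= a <oo) mu (B `&` coord_gt l a).
Proof.
transitivity (\int[mu]_y \sum_(0 <= a <oo) (\1_(B `&` coord_gt l a) y)%:E).
  apply: eq_integral => y _; rewrite EFinM (nat_layer_cake (y l)) -nneseriesZl//.
  apply: eq_eseriesr => a _; rewrite -EFinM; congr EFin.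
  rewrite !indicE in_setI -[y \in coord_gt l a]coord_gtE.
  by case: (y \in B); rewrite ?mul1r ?mul0r.
rewrite integral_nneseries//.
- by apply: eq_eseriesr => a _; rewrite integral_indic// setIT.
Qed.

Lemma integral_coord l :
  \int[mu]_y ((y l)%:R : R)%:E = \sum_(0 <= a <oo) mu (coord_gt l a).
Proof.
rewrite -[RHS](eq_eseriesr (fun a _ => congr1 mu (setTI (coord_gt l a)))).
rewrite -integral_indic_coord; apply: eq_integral => y _.
by rewrite indicE in_setT mul1r.
Qed.

Lemma integral_coord_mul_independent l l' (c c' : R) :
  (forall B, mu B \is a fin_num) ->
  (forall a b, mu (coord_gt l a `&` coord_gt l' b) =
               mu (coord_gt l a) * mu (coord_gt l' b)) ->
  \int[mu]_y ((y l)%:R : R)%:E = c%:E ->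
  \int[mu]_y ((y l')%:R : R)%:E = c'%:E ->
  \int[mu]_y ((y l)%:R * (y l')%:R : R)%:E = (c * c')%:E.
Proof.
move=> mufin ind cE c'E.
transitivity (\int[mu]_y \sum_(0 <= a <oo) (\1_(coord_gt l a) y * (y l')%:R)%:E).
  apply: eq_integral => y _; rewrite mulrC EFinM (nat_layer_cake (y l)) -nneseriesZl//.
  apply: eq_eseriesr => a _; by rewrite -EFinM mulrC indicE -coord_gtE.
rewrite integral_nneseries//.
transitivity (\sum_(0 <= a <oo) c'%:E * mu (coord_gt l a)).
  apply: eq_eseriesr => a _; rewrite integral_indic_coord -c'E integral_coord.
  under eq_eseriesr do rewrite ind -(fineK (mufin (coord_gt l a))).
  by rewrite nneseriesZl// fineK// muleC.
by rewrite nneseriesZl// -integral_coord cE EFinM muleC.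
Qed.

Lemma integral_coord_sqr l :
  \int[mu]_y ((y l)%:R ^+ 2 : R)%:E =
  \sum_(0 <= a <oo) (a%:R ^+ 2)%:E * mu [set y | y l = a].
Proof.
have cover : \bigcup_a [set y : S | y l = a] = setT.
  by apply/seteqP; split=> // y _; exists (y l).
rewrite -cover ge0_integral_bigcup//.
- apply: eq_eseriesr => a _; rewrite -integral_cst//.
  by apply: eq_integral => y; rewrite inE => /= ->.
- by apply/trivIsetP => a b _ _ /eqP ab; apply/seteqP; split=> // y [/= -> /ab].
Qed.

End coordinate_moments.

Section poisson.
Context {R : realType}.

(** Absorbing the square into a power of 2 turns the second moment of a Poisson law
    of mean r into the exponential series of 2 r. *)
Lemma sqr_le_exp2n (n : nat) : (n ^ 2 <= 4 * 2 ^ n)%N.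
Proof.
suff : (n ^ 2 + 2 * n + 3 <= 4 * 2 ^ n)%N by lia.
elim: n => [//|n IH]; rewrite [(2 ^ n.+1)%N]expnS; move: IH; rewrite -!mulnn.
move: (2 ^ n)%N => m; nia.
Qed.

Lemma poisson_second_moment (rate : R) : 0 <= rate ->
  (\sum_(0 <= a <oo) (a%:R ^+ 2)%:E * poisson_prob rate 0%N [set a] <=
   (4 * expR rate)%:E)%E.
Proof.
move=> r0; rewrite /poisson_prob; case: (boolP (0 < rate)) => [r_gt0|_]; last first.
  rewrite eseries0 => [|[|a] _ _]; first by rewrite lee_fin mulr_ge0 ?expR_ge0.
    by rewrite expr0n mul0e.
  by rewrite diracE memNset ?mule0.
pose u a := 4 * expR (- rate) * exp_coeff (2 * rate) a.
have cu : cvgn (series u) by apply: cvg_series_scale; exact: is_cvg_series_exp_coeff.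
have -> : 4 * expR rate = limn (series u).
  rewrite lim_series_scale; last exact: is_cvg_series_exp_coeff.
  by rewrite -/(expR (2 * rate)) -mulrA -expRD; congr (_ * expR _); ring.
rewrite -eseries_EFin//; last first.
  by move=> a; rewrite mulr_ge0 ?exp_coeff_ge0 ?mulr_ge0 ?expR_ge0.
apply: lee_nneseries => [a _|a _].
  by rewrite mule_ge0// ?lee_fin ?exprn_ge0// esum_ge0// => b _; rewrite lee_fin poisson_pmf_ge0.
rewrite esum_set1; last by rewrite lee_fin poisson_pmf_ge0.
rewrite /poisson_pmf r_gt0 -EFinM lee_fin /u /exp_coeff/=.
rewrite exprMn.
rewrite [leRHS](_ : _ = 4 * 2 ^+ a * (rate ^+ a * a`!%:R^-1 * expR (- rate))); last by ring.
rewrite ler_wpM2r ?mulr_ge0 ?exprn_ge0 ?expR_ge0//.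
by rewrite -!natrX -natrM ler_nat sqr_le_exp2n.
Qed.

End poisson.

(** * Covariances under an independent initial law *)

Section covariance.
Context {R : realType} {N : nat} {d : measure_display} {T : measurableType d}
  {P : probability T R}.
Local Notation S := (urn_state N).
Context (Y Z : {RV P >-> S}) (k : S -> {measure set S -> \bar R}).
Hypothesis law : forall f : S -> \bar R, (forall y, 0 <= f y)%E ->
  (\int[P]_w f (Z w) = \int[P]_w \int[k (Y w)]_y f y)%E.
Context (c v : 'I_N -> R).
Hypothesis mean_coord : forall l, (\int[P]_w ((Y w l)%:R : R)%:E = (c l)%:E)%E.
Hypothesis mean_mul : forall l l', l != l' ->
  (\int[P]_w ((Y w l)%:R * (Y w l')%:R : R)%:E = (c l * c l')%:E)%E.
Hypothesis mean_sqr : forall l, (\int[P]_w ((Y w l)%:R ^+ 2 : R)%:E = (v l)%:E)%E.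

Lemma measurable_urn_rv {d'} {U : measurableType d'} (W : {RV P >-> S}) (f : S -> U) :
  measurable_fun setT (fun w => f (W w)).
Proof. by apply: (measurableT_comp (f := f)); first exact: measurable_fun_urn. Qed.

Lemma dot_ge0 (x : S) (m : 'I_N -> R) : (forall l, 0 <= m l) -> 0 <= dot x m.
Proof. by move=> m0; apply: sumr_ge0 => l _; rewrite mulr_ge0. Qed.

Lemma integral_dot (m : 'I_N -> R) : (forall l, 0 <= m l) ->
  (\int[P]_w (dot (Y w) m)%:E = (\sum_l m l * c l)%:E)%E.
Proof.
move=> m0; rewrite -sumEFin.
under eq_integral do rewrite /dot -sumEFin.
rewrite ge0_integral_sum//.
- apply: eq_bigr => l _; rewrite EFinM -mean_coord -ge0_integralZl//.
  + by apply: eq_integral => w _; rewrite -EFinM mulrC.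
  + exact: (measurable_urn_rv Y (fun x => ((x l)%:R)%:E)).
  + by rewrite lee_fin.
- by move=> l; exact: (measurable_urn_rv Y (fun x => ((x l)%:R * m l)%:E)).
- by move=> l w _; rewrite lee_fin mulr_ge0.
Qed.

(** By independence the off-diagonal terms factor, so this differs from the product
    of the two integrals by a diagonal sum only, weighted by the variances. *)
Lemma integral_dot_mul (m m' : 'I_N -> R) :
  (forall l, 0 <= m l) -> (forall l, 0 <= m' l) ->
  (\int[P]_w (dot (Y w) m * dot (Y w) m')%:E =
   ((\sum_l m l * c l) * (\sum_l m' l * c l) +
    \sum_l m l * m' l * (v l - c l ^+ 2))%:E)%E.
Proof.
move=> m0 m'0.
pose q l l' := if l == l' then v l else c l * c l'.
have qE l l' : (\int[P]_w ((Y w l)%:R * (Y w l')%:R : R)%:E = (q l l')%:E)%E.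
  rewrite /q; case: eqVneq => [->|]; last exact: mean_mul.
  by rewrite -mean_sqr; apply: eq_integral => w _; rewrite expr2.
transitivity ((\sum_l \sum_l' m l * m' l' * q l l')%:E).
  rewrite -sumEFin.
  transitivity (\int[P]_w \sum_l (\sum_l' m l * m' l' * ((Y w l)%:R * (Y w l')%:R))%:E)%E.
    apply: eq_integral => w _; rewrite sumEFin /dot mulr_suml; congr EFin.
    apply: eq_bigr => l _; rewrite mulr_sumr; apply: eq_bigr => l' _; ring.
  rewrite ge0_integral_sum//; last 2 first.
  - by move=> l; exact: (measurable_urn_rv Y
      (fun x => (\sum_l' m l * m' l' * ((x l)%:R * (x l')%:R))%:E)).
  - by move=> l w _; rewrite lee_fin; apply: sumr_ge0 => l' _; rewrite !mulr_ge0.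
  apply: eq_bigr => l _; rewrite -sumEFin; under eq_integral do rewrite -sumEFin.
  rewrite ge0_integral_sum//; last 2 first.
  - by move=> l'; exact: (measurable_urn_rv Y
      (fun x => (m l * m' l' * ((x l)%:R * (x l')%:R))%:E)).
  - by move=> l' w _; rewrite lee_fin !mulr_ge0.
  apply: eq_bigr => l' _; rewrite EFinM -qE -ge0_integralZl//.
  - exact: (measurable_urn_rv Y (fun x => ((x l)%:R * (x l')%:R)%:E)).
  - by rewrite lee_fin mulr_ge0.
congr EFin; rewrite mulr_suml -big_split/=; apply: eq_bigr => l _.
rewrite mulr_sumr.
have -> : m l * m' l * (v l - c l ^+ 2) =
    \sum_l' (l' == l)%:R * (m l * m' l' * (v l' - c l' ^+ 2)).
  by rewrite (bigD1 l)//= eqxx mul1r big1 ?addr0// => l' /negPf ->; rewrite mul0r.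
rewrite -big_split/=; apply: eq_bigr => l' _; rewrite /q eq_sym.
by case: eqP => [->|_] /=; ring.
Qed.

(** The covariance splits into the mean of the conditional covariances given the
    initial state, at most [D * dot x h], and the covariance of the conditional means,
    which is a diagonal sum by [integral_dot_mul]. *)
Lemma covariance_mixture_le (a b : 'I_N) (m m' h : 'I_N -> R) (D : R) :
  (forall l, 0 <= m l) -> (forall l, 0 <= m' l) -> (forall l, 0 <= h l) -> 0 <= D ->
  (forall x : S, \int[k x]_y ((y a)%:R : R)%:E = (dot x m)%:E)%E ->
  (forall x : S, \int[k x]_y ((y b)%:R : R)%:E = (dot x m')%:E)%E ->
  (forall x : S, (dot x m * dot x m' - D * dot x h)%:E <=
     \int[k x]_y ((y a)%:R * (y b)%:R : R)%:E <=
     (dot x m * dot x m' + D * dot x h)%:E)%E ->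
  (`|covariance P (fun w => (Z w a)%:R) (fun w => (Z w b)%:R)| <=
   (\sum_l m l * m' l * (v l + c l ^+ 2) + D * \sum_l h l * c l)%:E)%E.
Proof.
move=> m0 m'0 h0 D0 mE m'E sm.
pose g (x : S) := (\int[k x]_y ((y a)%:R * (y b)%:R : R)%:E)%E.
have g0 x : (0 <= g x)%E by apply: integral_ge0 => y _; rewrite lee_fin mulr_ge0.
have dotmm0 (x : S) : 0 <= dot x m * dot x m' by rewrite mulr_ge0 ?dot_ge0.
have Dh0 (x : S) : 0 <= D * dot x h by rewrite mulr_ge0 ?dot_ge0.
pose mu := \sum_l m l * c l; pose mu' := \sum_l m' l * c l.
pose eta := D * \sum_l h l * c l; pose q := \sum_l m l * m' l * (v l - c l ^+ 2).
have IDh : (\int[P]_w (D * dot (Y w) h)%:E = eta%:E)%E.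
  under eq_integral do rewrite EFinM.
  rewrite ge0_integralZl//; first by rewrite integral_dot// -EFinM.
  - exact: (measurable_urn_rv Y (fun x => (dot x h)%:E)).
  - by move=> w _; rewrite lee_fin dot_ge0.
have IQ := integral_dot_mul m0 m'0.
have mg : measurable_fun setT (g \o Y) := measurable_urn_rv Y g.
have up : (\int[P]_w g (Y w) <= (mu * mu' + q + eta)%:E)%E.
  rewrite EFinD -IQ -IDh -ge0_integralD//; last 4 first.
  - by move=> w _; rewrite lee_fin.
  - exact: (measurable_urn_rv Y (fun x => (dot x m * dot x m')%:E)).
  - by move=> w _; rewrite lee_fin.
  - exact: (measurable_urn_rv Y (fun x => (D * dot x h)%:E)).
  apply: ge0_le_integral => //.
  - exact: (measurable_urn_rv Y (fun x => (dot x m * dot x m')%:E + (D * dot x h)%:E)%E).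
  - by move=> w _; rewrite -EFinD; case/andP: (sm (Y w)).
have lo : ((mu * mu' + q)%:E <= \int[P]_w g (Y w) + eta%:E)%E.
  rewrite -IQ -IDh -ge0_integralD//; last 2 first.
  - by move=> w _; rewrite lee_fin.
  - exact: (measurable_urn_rv Y (fun x => (D * dot x h)%:E)).
  apply: ge0_le_integral => //.
  - by move=> w _; rewrite lee_fin.
  - exact: (measurable_urn_rv Y (fun x => (dot x m * dot x m')%:E)).
  - exact: (measurable_urn_rv Y (fun x => g x + (D * dot x h)%:E)%E).
  - move=> w _; have /andP[+ _] := sm (Y w); rewrite -/(g (Y w)).
    by rewrite EFinB leeBlDr.
have gfin : (\int[P]_w g (Y w))%E \is a fin_num.
  by rewrite ge0_fin_numE ?(le_lt_trans up) ?ltry//; apply: integral_ge0.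
have [z zE] : exists z, (\int[P]_w g (Y w))%E = z%:E.
  by exists (fine (\int[P]_w g (Y w))%E); rewrite fineK.
have EZab : (\int[P]_w ((Z w a)%:R * (Z w b)%:R : R)%:E = z%:E)%E.
  rewrite -zE; apply: (law (f := fun y : S => ((y a)%:R * (y b)%:R)%:E)) => y.
  by rewrite lee_fin mulr_ge0.
have EZa : (\int[P]_w ((Z w a)%:R : R)%:E = mu%:E)%E.
  rewrite (law (f := fun y : S => ((y a)%:R)%:E))//.
  by under eq_integral do rewrite mE; rewrite integral_dot.
have EZb : (\int[P]_w ((Z w b)%:R : R)%:E = mu'%:E)%E.
  rewrite (law (f := fun y : S => ((y b)%:R)%:E))//.
  by under eq_integral do rewrite m'E; rewrite integral_dot.
have lfun (f : S -> R) (r : R) : (forall y, 0 <= f y) ->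
    (\int[P]_w (f (Z w))%:E = r%:E)%E -> (fun w => f (Z w)) \in Lfun P 1.
  move=> f0 fr; apply/Lfun1_integrable/integrableP; split.
    exact: (measurable_urn_rv Z (fun x => (f x)%:E)).
  rewrite (_ : (\int[P]_x _ = r%:E)%E) ?ltry// -fr; apply: eq_integral => w _ /=.
  by rewrite ger0_norm.
rewrite covarianceE; last 3 first.
- exact: (lfun (fun y : S => (y a)%:R) mu).
- exact: (lfun (fun y : S => (y b)%:R) mu').
- by apply: (lfun (fun y : S => (y a)%:R * (y b)%:R) z) => // y; rewrite mulr_ge0.
rewrite unlock EZab EZa EZb -EFinM -EFinB /= lee_fin.
move: up lo; rewrite zE -EFinD !lee_fin => up lo.
have qle : `|q| <= \sum_l m l * m' l * (v l + c l ^+ 2).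
  rewrite (le_trans (ler_norm_sum _ _ _))// ler_sum// => l _.
  have v0 : 0 <= v l.
    by rewrite -lee_fin -mean_sqr; apply: integral_ge0 => w _; rewrite lee_fin exprn_ge0.
  have cc : 0 <= c l ^+ 2 by rewrite exprn_even_ge0.
  rewrite normrM ger0_norm ?mulr_ge0// ler_wpM2l ?mulr_ge0//.
  by rewrite ler_norml; apply/andP; split; lra.
rewrite (@le_trans _ _ (`|q| + eta))//; last by rewrite lerD2r.
have := ler_norm q; have := ler_norm (- q); rewrite normrN => nq pq.
rewrite ler_norml; apply/andP; split; lra.
Qed.

End covariance.

(** * Mean-field bounds on the rates of the urns *)

Section torus_bounds.
Context {R : realType}.

(** The moment assumptions give weight 0 to deaths without children; their rates, as
    well as the initial means, are bounded by continuity on a compact set. *)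
Lemma unit_interval_bounded (f : R -> R) : continuous f ->
  exists M : R, forall u : R, 0 <= u <= 1 -> `|f u| <= M.
Proof.
move=> cf; have cK : compact `[0 : R, 1]%classic by exact: segment_compact.
have /compact_bounded[M [_ MP]] : compact (f @` `[0 : R, 1]%classic).
  by apply: continuous_compact => //; exact: continuous_subspaceT.
exists (M + 1) => u u01; apply: MP; first by rewrite ltrDl.
by exists u => //=; rewrite in_itv.
Qed.

Lemma unit_square_bounded (f : R -> R -> R) :
  continuous (fun z : R * R => f z.1 z.2) ->
  exists M : R, forall u v : R, 0 <= u <= 1 -> 0 <= v <= 1 -> `|f u v| <= M.
Proof.
move=> cf; have cK : compact (`[0 : R, 1]%classic `*` `[0 : R, 1]%classic).
  by apply: compact_setX; exact: segment_compact.
have /compact_bounded[M [_ MP]] : compact ((fun z : R * R => f z.1 z.2) @`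
    (`[0 : R, 1]%classic `*` `[0 : R, 1]%classic)).
  by apply: continuous_compact => //; exact: continuous_subspaceT.
exists (M + 1) => u v u01 v01; apply: MP; first by rewrite ltrDl.
by exists (u, v) => //=; split; rewrite /= in_itv.
Qed.

Lemma site_torus (N : nat) (i : 'I_N) : torus (site i : R).
Proof.
have N0 : (0 < N)%N by exact: leq_ltn_trans (leq0n i) (ltn_ord i).
rewrite /torus /= in_itv /= /site divr_gt0 ?ltr0n//= ler_pdivrMr ?ltr0n//.
by rewrite mul1r ler_nat.
Qed.

Lemma torus_unit (u : R) : torus u -> 0 <= u <= 1.
Proof. by rewrite /torus /= in_itv /= => /andP[/ltW -> ->]. Qed.

End torus_bounds.

Section rates.
Context {R : realType} (eps0 : R).
Hypothesis eps0_gt0 : 0 < eps0.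
Let e := Num.min eps0 1.

Lemma weight_le_powR (k : nat) : (0 < k)%N -> weight e k <= 8 * k%:R `^ (2 + eps0).
Proof.
move=> k0.
have k1 : 1 <= k%:R :> R by rewrite ler1n.
have k2 : k.+1%:R <= 2 * k%:R :> R by rewrite -natrM ler_nat; lia.
have e0 : 0 <= e by rewrite le_min ler01 ltW.
have k00 : (k%:R != 0 :> R) by rewrite pnatr_eq0 -lt0n.
rewrite powRD ?k00 ?implybT// powR_mulrn//.
rewrite (_ : 8 * _ = (2 * k%:R) ^+ 2 * (2 * k%:R `^ eps0)); last by ring.
rewrite /weight ler_pM ?exprn_ge0 ?powR_ge0//.
  by rewrite lerXn2r ?nnegrE// mulr_ge0.
rewrite (@le_trans _ _ ((2 * k%:R) `^ e))//.
  by rewrite ge0_ler_powR ?nnegrE ?mulr_ge0.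
rewrite powRM// ler_pM ?powR_ge0//.
  by rewrite -[leRHS]powRr1// ler_powR// ?ler1n// ge_min lexx orbT.
by rewrite ler_powR// ge_min lexx.
Qed.

(** The term k = 0, which the weights k^(2 + eps0) ignore, is controlled by [A0]. *)
Lemma weighted_sum_bound (a : R^nat) (B A0 : R) : (forall k, 0 <= a k) ->
  (weighted_sum eps0 a <= B%:E)%E -> a 0%N <= A0 ->
  cvgn (series (fun k => a k * weight e k)) /\
  limn (series (fun k => a k * k.+1%:R ^+ 2)) <= 8 * B + A0.
Proof.
move=> a0 aB aA0.
have e0 : 0 < e by rewrite lt_min ltr01 eps0_gt0.
pose u k := k%:R `^ (2 + eps0) * a k.
have u0 k : 0 <= u k by rewrite mulr_ge0 ?powR_ge0.
have cu : cvgn (series u).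
  by apply: nnseries_is_cvg => //; exact: le_lt_trans aB (ltry _).
have uB : limn (series u) <= B by rewrite -lee_fin -eseries_EFin.
(* The coefficients of exp(0) single out the index 0. *)
pose w k := 8 * u k + a 0%N * exp_coeff 0 k.
have c8 : cvgn (series (fun k => 8 * u k)) by exact: cvg_series_scale.
have c0 : cvgn (series (fun k => a 0%N * exp_coeff (0 : R) k)).
  by apply: cvg_series_scale; exact: is_cvg_series_exp_coeff.
have cw : cvgn (series w) by exact: cvg_series_add.
have aw k : a k * weight e k <= w k.
  case: k => [|k].
    rewrite /w /u /weight /exp_coeff/= expr0 fact0 divr1 expr1n powR1 !mulr1.
    by rewrite lerDr mulr_ge0// mulr_ge0// powR_ge0.
  rewrite /w /exp_coeff/= expr0n/= mul0r mulr0 addr0 mulrC /u mulrA.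
  by rewrite ler_wpM2r// weight_le_powR.
have ca : cvgn (series (fun k => a k * weight e k)).
  apply: (cvg_series_dominated _ cw) => k.
  by rewrite ger0_norm// mulr_ge0// weight_ge0.
have sqr_weight k : a k * k.+1%:R ^+ 2 <= a k * weight e k.
  by rewrite ler_wpM2l// weight_ge_sqr.
split=> //; rewrite (@le_trans _ _ (limn (series w)))//.
  apply: lim_series_mono => //; first by move=> k; exact: le_trans (aw k).
  apply: (cvg_series_dominated _ ca) => k.
  by rewrite ger0_norm// mulr_ge0// exprn_ge0.
rewrite (lim_series_add c8 c0) !lim_series_scale//; last exact: is_cvg_series_exp_coeff.
by rewrite -/(expR 0) expR0 mulr1 lerD// ler_wpM2l.
Qed.

End rates.

Section urn_rates.
Context {R : realType} {N : nat}
  (lam : nat -> R -> R -> R) (psi : nat -> R -> R) (e : R).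
Local Notation S := (urn_state N).

Definition urn_rate (k : nat) (i j : 'I_N) : R :=
  if i == j then psi k (site i) else N%:R^-1 * lam k (site i) (site j).

Hypotheses (N_gt0 : (0 < N)%N) (e_gt0 : 0 < e).
Hypothesis rate_ge0 : forall k i j, 0 <= urn_rate k i j.
Hypothesis rate_weight : forall i j,
  cvgn (series (fun k => urn_rate k i j * weight e k)).

Lemma stay_branch k (i : 'I_N) (x : S) : (0 < x i)%N -> stay k i x = branch k i i x.
Proof.
move=> xi; apply/ffunP => l; rewrite !ffunE.
by case: eqVneq => [->|_]; lia.
Qed.

Lemma move_branch k (i j : 'I_N) (x : S) : j != i -> move k i j x = branch k i j x.
Proof.
move=> ji; apply/ffunP => l; rewrite !ffunE.
case: (eqVneq l i) => [->|_]; first by rewrite eq_sym (negPf ji); lia.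
by case: eqVneq => [->|_]; lia.
Qed.

Lemma urn_generatorE (f : S -> R) (x : S) : dominated e f ->
  urn_generator lam psi f x = branching_generator urn_rate f x.
Proof.
move=> df.
have N0 : N%:R != 0 :> R by rewrite pnatr_eq0 gtn_eqF.
pose u i j k := urn_rate k i j * (f (branch k i j x) - f x).
have cu i j : cvgn (series (u i j)).
  exact: (@cvg_jump _ _ urn_rate e e_gt0 rate_ge0 rate_weight f i j x df).
have cscale c i j : cvgn (series (fun k => c * u i j k)) by exact: cvg_series_scale.
have E1 : limn (series (fun k => \sum_(i < N) \sum_(j < N | j != i)
      (x i)%:R * lam k (site i) (site j) * (f (move k i j x) - f x))) =
    \sum_(i < N) \sum_(j < N | j != i) (N%:R * (x i)%:R) * limn (series (u i j)).
  transitivity (limn (series (fun k => \sum_(i < N) \sum_(j < N | j != i)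
      (N%:R * (x i)%:R) * u i j k))).
    congr (limn (series _)); apply/funext => k; apply: eq_bigr => i _.
    apply: eq_bigr => j ji; rewrite move_branch// /u /urn_rate eq_sym (negPf ji).
    by field.
  rewrite lim_series_sum; last by move=> i; apply: cvg_series_sum => j; exact: cscale.
  apply: eq_bigr => i _; rewrite lim_series_sum; last by move=> j; exact: cscale.
  by apply: eq_bigr => j _; rewrite lim_series_scale.
have E2 : limn (series (fun k =>
      \sum_(i < N) (x i)%:R * psi k (site i) * (f (stay k i x) - f x))) =
    \sum_(i < N) (x i)%:R * limn (series (u i i)).
  transitivity (limn (series (fun k => \sum_(i < N) (x i)%:R * u i i k))).
    congr (limn (series _)); apply/funext => k; apply: eq_bigr => i _.
    have [->|xi] := posnP (x i); first by rewrite !mul0r.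
    by rewrite stay_branch// /u /urn_rate eqxx mulrA.
  rewrite lim_series_sum; last by move=> i; exact: cscale.
  by apply: eq_bigr => i _; rewrite lim_series_scale.
rewrite /urn_generator E1 E2 mulr_sumr -big_split/=; apply: eq_bigr => i _.
rewrite [RHS](bigD1 i)//= addrC; congr (_ + _).
rewrite mulr_sumr; apply: eq_bigr => j _.
by rewrite -/(u i j) mulrA mulKf.
Qed.

End urn_rates.

Section initial_law.
Context {R : realType} {N : nat} {d : measure_display} {T : measurableType d}
  {P : probability T R}.
Local Notation S := (urn_state N).
Context (phi : R -> R) (Y : {RV P >-> S}) (Phi : R).
Hypothesis phi_ge0 : forall u, 0 <= phi u.
Hypothesis phi_le : forall u, torus u -> phi u <= Phi.
Hypothesis Y_independent : independent_coords P Y.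
Hypothesis Y_poisson : poisson_coords P phi Y.

Let V := 4 * expR Phi.

Let law_integral (f : S -> \bar R) : (forall y, (0 <= f y)%E) ->
  (\int[P]_w f (Y w) = \int[distribution P Y]_y f y)%E.
Proof.
by move=> f0; rewrite ge0_integral_distribution//; exact: measurable_fun_urn.
Qed.

Lemma integral_sqr_le l : (\int[P]_w ((Y w l)%:R ^+ 2 : R)%:E <= V%:E)%E.
Proof.
rewrite (law_integral (f := fun y => ((y l)%:R ^+ 2)%:E)); last first.
  by move=> y; rewrite lee_fin exprn_ge0.
rewrite integral_coord_sqr.
have -> : (\sum_(0 <= a <oo) (a%:R ^+ 2)%:E * distribution P Y [set y | y l = a] =
    \sum_(0 <= a <oo) (a%:R ^+ 2)%:E * poisson_prob (phi (site l)) 0%N [set a])%E.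
  by apply: eq_eseriesr => a _; rewrite -(Y_poisson l [set a]).
rewrite (le_trans (poisson_second_moment (phi_ge0 _)))// lee_fin ler_wpM2l// ler_expR.
by rewrite phi_le//; exact: site_torus.
Qed.

(** The initial law enters the covariance estimate through these moments. Their
    bound depends neither on the number of urns nor on the urn. *)
Lemma initial_moments : exists c v : 'I_N -> R,
  [/\ forall l, (\int[P]_w ((Y w l)%:R : R)%:E = (c l)%:E)%E,
      forall l l', l != l' ->
        (\int[P]_w ((Y w l)%:R * (Y w l')%:R : R)%:E = (c l * c l')%:E)%E,
      forall l, (\int[P]_w ((Y w l)%:R ^+ 2 : R)%:E = (v l)%:E)%E,
      forall l, 0 <= c l <= V & forall l, v l <= V].
Proof.
have mle l : (\int[P]_w ((Y w l)%:R : R)%:E <= \int[P]_w ((Y w l)%:R ^+ 2 : R)%:E)%E.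
  apply: ge0_le_integral => //.
  - exact: (measurable_urn_rv Y (fun x => ((x l)%:R)%:E)).
  - exact: (measurable_urn_rv Y (fun x => ((x l)%:R ^+ 2)%:E)).
  - move=> w _; rewrite lee_fin -natrX ler_nat; case: (Y w l) => // n.
    by rewrite -mulnn leq_pmulr.
have fin (f : T -> R) : (forall w, 0 <= f w) -> (\int[P]_w (f w)%:E <= V%:E)%E ->
    (\int[P]_w (f w)%:E = (fine (\int[P]_w (f w)%:E))%:E)%E.
  move=> f0 fV; rewrite fineK// ge0_fin_numE ?(le_lt_trans fV) ?ltry//.
  by apply: integral_ge0 => w _; rewrite lee_fin.
pose c l := fine (\int[P]_w ((Y w l)%:R : R)%:E)%E.
pose v l := fine (\int[P]_w ((Y w l)%:R ^+ 2 : R)%:E)%E.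
have cE l : (\int[P]_w ((Y w l)%:R : R)%:E = (c l)%:E)%E.
  by apply: fin => //; exact: le_trans (mle l) (integral_sqr_le l).
have vE l : (\int[P]_w ((Y w l)%:R ^+ 2 : R)%:E = (v l)%:E)%E.
  by apply: (fin (fun w => (Y w l)%:R ^+ 2)) => [w|]; [exact: exprn_ge0|exact: integral_sqr_le].
exists c, v; split=> //.
- move=> l l' ll'.
  rewrite (law_integral (f := fun y => ((y l)%:R * (y l')%:R)%:E)); last first.
    by move=> y; rewrite lee_fin mulr_ge0.
  apply: integral_coord_mul_independent.
  + by move=> B; exact: fin_num_measure.
  + move=> a b.
    have := Y_independent [set l; l']%SET
      (fun i => if i == l then [set n | (a < n)%N] else [set n | (b < n)%N]).
    rewrite big_setU1/= ?inE// big_set1 eqxx eq_sym (negPf ll') => <-.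
    rewrite /distribution /= /pushforward; congr (P _).
    apply/seteqP; split=> w.
      move=> [/= la l'b] i /=; rewrite !inE => /orP[]/eqP ->; rewrite ?eqxx//.
      by rewrite eq_sym (negPf ll').
    move=> /= H; split; rewrite /coord_gt/=.
      by have := H l; rewrite /= !inE eqxx/=; exact.
    by have := H l'; rewrite /= !inE eqxx orbT eq_sym (negPf ll'); exact.
  + by rewrite -law_integral.
  + by rewrite -law_integral.
- move=> l; rewrite -!lee_fin -cE; apply/andP; split.
    by apply: integral_ge0 => w _; rewrite lee_fin.
  exact: le_trans (mle l) (integral_sqr_le l).
- by move=> l; rewrite -lee_fin -vE integral_sqr_le.
Qed.

End initial_law.

Lemma ereal_sup_bound {R : realType} (A : set (\bar R)) : (ereal_sup A < +oo)%E ->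
  exists2 B : R, 0 <= B & forall x, A x -> (x <= B%:E)%E.
Proof.
move=> supA.
have [B supB] : exists B : R, (ereal_sup A <= B%:E)%E.
  case: (ereal_sup A) supA => [r _|//|_]; first by exists r.
  by exists 0; rewrite leNye.
exists `|B| => // x Ax.
rewrite (le_trans (ereal_sup_ubound Ax))// (le_trans supB)// lee_fin ler_norm//.
Qed.

(** * The covariance bound *)

Theorem lemma3p1 (R : realType)
  (lam : nat -> R -> R -> R) (psi : nat -> R -> R) (phi : R -> R) (eps0 : R)
  (lam_smooth : forall k, torus2_smooth (lam k))
  (psi_smooth : forall k, torus_smooth (psi k))
  (phi_smooth : torus_smooth phi)
  (lam_ge0 : forall k u v, 0 <= lam k u v)
  (psi_ge0 : forall k u, 0 <= psi k u)
  (phi_ge0 : forall u, 0 <= phi u)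
  (eps0_gt0 : 0 < eps0)
  (lam_sup : (ereal_sup [set weighted_sum eps0 (fun k => lam k u v)
                        | u in torus & v in torus] < +oo)%E)
  (psi_sup : (ereal_sup [set weighted_sum eps0 (fun k => psi k u)
                        | u in torus] < +oo)%E)
  (lam_sum_smooth :
     torus2_smooth (fun u v => fine (weighted_sum eps0 (fun k => lam k u v))))
  (psi_sum_smooth :
     torus_smooth (fun u => fine (weighted_sum eps0 (fun k => psi k u))))
  (d : nat -> measure_display) (T : forall N : nat, measurableType (d N))
  (P : forall N : nat, probability (T N) R)
  (X : forall N : nat, R -> {RV (P N) >-> urn_state N})
  (X_process : forall N, (0 < N)%N -> urn_branching_process lam psi (X N))
  (X0_independent : forall N, (0 < N)%N -> independent_coords (P N) (X N 0))
  (X0_poisson : forall N, (0 < N)%N -> poisson_coords (P N) phi (X N 0))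
  (t : R) (t_ge0 : 0 <= t) :
  exists C1 : R, forall (N : nat) (i j : 'I_N) (s : R),
    (0 < N)%N -> i != j -> 0 <= s <= t ->
    (`| covariance (P N) (fun w => (X N s w i)%:R) (fun w => (X N s w j)%:R) |
       <= (C1 / N%:R)%:E)%E.

Proof.
have [Bl Bl0 lamB] := ereal_sup_bound lam_sup.
have [Bp Bp0 psiB] := ereal_sup_bound psi_sup.
have [_ _ /(_ 0%N) lam0_cont] := lam_smooth 0%N.
have [_ /(_ 0%N) psi0_cont] := psi_smooth 0%N.
have [_ /(_ 0%N) phi_cont] := phi_smooth.
have [Ml lam0M] := unit_square_bounded lam0_cont.
have [Mp psi0M] := unit_interval_bounded psi0_cont.
have [Phi phiM] := unit_interval_bounded phi_cont.
pose e := Num.min eps0 1.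
have e_gt0 : 0 < e by rewrite lt_min eps0_gt0 ltr01.
have e_le1 : e <= 1 by rewrite ge_min lexx orbT.
pose K := (8 * Bl + `|Ml|) + (8 * Bp + `|Mp|).
have K0 : 0 <= K by rewrite !addr_ge0// mulr_ge0.
pose V := 4 * expR Phi.
have V0 : 0 <= V by rewrite mulr_ge0 ?expR_ge0.
pose E := expR (3 * K * t).
pose D := error_rate K t.
(* The first term bounds the covariance of the conditional means, the second one the
   mean of the conditional covariances; 3 / N is the sum of the products of two
   profiles. *)
exists (3 * (V + V ^+ 2) * E ^+ 2 + 3 * D * V) => N a b s N_gt0 ab /andP[s0 st].
have [p [p_sg p_gen p_markov]] := X_process N N_gt0.
have sites (i : 'I_N) : torus (site i : R) by exact: site_torus.
have sites01 (i : 'I_N) : 0 <= (site i : R) <= 1 by exact: torus_unit.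
pose r := @urn_rate R N lam psi.
have r0 k i j : 0 <= r k i j.
  by rewrite /r /urn_rate; case: eqP => _ //; rewrite mulr_ge0// invr_ge0.
have le_norm (x y : R) : `|x| <= y -> x <= `|y|.
  by move=> xy; rewrite (le_trans (ler_norm x))// (le_trans xy)// ler_norm.
have rate_bounds i j : cvgn (series (fun k => r k i j * weight e k)) /\
    limn (series (fun k => r k i j * k.+1%:R ^+ 2)) <= K * ((i == j)%:R + N%:R^-1).
  rewrite /r /urn_rate; have [_|ij] := eqVneq i j.
    have psiw : (weighted_sum eps0 (fun k => psi k (site i)) <= Bp%:E)%E.
      by apply: psiB; exists (site i).
    have [cpsi lpsi] := weighted_sum_bound eps0_gt0 (fun k => psi_ge0 k (site i))
      psiw (le_norm _ _ (psi0M _ (sites01 i))).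
    split=> //; rewrite (le_trans lpsi)// (@le_trans _ _ K)//.
      by rewrite lerDr addr_ge0// mulr_ge0.
    by rewrite ler_peMr// lerDl invr_ge0.
  have lamw : (weighted_sum eps0 (fun k => lam k (site i) (site j)) <= Bl%:E)%E.
    by apply: lamB; exists (site i) => //; exists (site j).
  have [clam llam] := weighted_sum_bound eps0_gt0
    (fun k => lam_ge0 k (site i) (site j)) lamw
    (le_norm _ _ (lam0M _ _ (sites01 i) (sites01 j))).
  have scaled (u : R^nat) : (fun k => N%:R^-1 * lam k (site i) (site j) * u k) =
      (fun k => N%:R^-1 * (lam k (site i) (site j) * u k)).
    by apply/funext => k; rewrite mulrA.
  rewrite !scaled; split; first exact: cvg_series_scale.
  rewrite lim_series_scale; last first.
    apply: (cvg_series_dominated _ clam) => k.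
    by rewrite ger0_norm ?mulr_ge0 ?exprn_ge0// ler_wpM2l// weight_ge_sqr.
  rewrite add0r mulrC ler_wpM2r ?invr_ge0// (le_trans llam)//.
  by rewrite lerDl addr_ge0// mulr_ge0.
have rw i j := (rate_bounds i j).1.
have rK i j := (rate_bounds i j).2.
have [m [m0 md mb]] := mean_flow e_gt0 r0 rw N_gt0 K0 rK a.
have [m' [m'0 m'd m'b]] := mean_flow e_gt0 r0 rw N_gt0 K0 rK b.
have GL (f : urn_state N -> R) x : dominated e f ->
    urn_generator lam psi f x = branching_generator r f x.
  exact: urn_generatorE.
have phi_le u : torus u -> phi u <= Phi.
  by move=> /torus_unit /phiM; apply: le_trans; exact: ler_norm.
have [c [v [cE ccE vE cV vV]]] :=
  initial_moments phi_ge0 phi_le (X0_independent N N_gt0) (X0_poisson N N_gt0).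
have law := markov_law p_markov s0.
have h0 l : 0 <= profile a l * profile b l :> R by rewrite mulr_ge0 ?profile_ge0.
have ms0 l : 0 <= m s l by case/andP: (mb s l s0).
have m's0 l : 0 <= m' s l by case/andP: (m'b s l s0).
have meanE (x : urn_state N) :=
  mean_identity e_gt0 e_le1 r0 rw N_gt0 K0 p_sg p_gen GL x m0 md mb s0.
have mean'E (x : urn_state N) :=
  mean_identity e_gt0 e_le1 r0 rw N_gt0 K0 p_sg p_gen GL x m'0 m'd m'b s0.
have pairE (x : urn_state N) :=
  second_moment_bounds e_gt0 e_le1 r0 rw N_gt0 K0 rK p_sg p_gen GL x
    ab m0 m'0 md m'd mb m'b s0.
have D0 := error_rate_ge0 K0 s.
have cov := covariance_mixture_le law cE ccE vE ms0 m's0 h0 D0 meanE mean'E pairE.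
apply: (le_trans cov).
rewrite lee_fin.
have E0 : 0 <= E by exact: expR_ge0.
have flow_le (q : R) : q <= expR (3 * K * s) -> q <= E.
  by move=> /le_trans; apply; rewrite ler_expR ler_wpM2l// mulr_ge0.
have mm l : m s l * m' s l <= E ^+ 2 * (profile a l * profile b l).
  rewrite expr2 mulrACA ler_pM//.
    have /andP[_ /le_trans] := mb s l s0; apply.
    by rewrite ler_wpM2r ?profile_ge0 ?flow_le.
  have /andP[_ /le_trans] := m'b s l s0; apply.
  by rewrite ler_wpM2r ?profile_ge0 ?flow_le.
have -> : (3 * (V + V ^+ 2) * E ^+ 2 + 3 * D * V) / N%:R =
    E ^+ 2 * (V + V ^+ 2) * (3 / N%:R) + D * (V * (3 / N%:R)) by ring.
rewrite -(@sum_profile_mul R N N_gt0 a b ab) lerD//.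
  rewrite mulr_sumr ler_sum// => l _.
  have /andP[cl0 clV] := cV l.
  have v0 : 0 <= v l.
    by rewrite -lee_fin -vE; apply: integral_ge0 => w _; rewrite lee_fin exprn_ge0.
  rewrite [leRHS]mulrAC ler_pM ?mulr_ge0 ?addr_ge0 ?exprn_ge0//.
  by rewrite lerD// lerXn2r ?nnegrE.
rewrite ler_pM ?error_rate_ge0 ?sumr_ge0//.
- by move=> l _; rewrite mulr_ge0//; case/andP: (cV l).
- exact: error_rate_le.
- rewrite mulr_sumr ler_sum// => l _; rewrite mulrC ler_wpM2r//.
  by case/andP: (cV l).
Qed.
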